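(* Let $N\geq 1$, $0<R\leq\infty$, and let $V_{1}\geq 0$ and $W_{1}$ be smooth functions on $(0,R)$. Assume that $(V_{1},W_{1})$ is an $N$-dimensional Bessel pair on $(0,R)$. If $$V_{1}''(r)-3\frac{V_{1}'(r)}{r}-(N-5)\frac{V_{1}(r)}{r^{2}}\leq 0\quad\text{on }(0,R),$$ then for all $u\in C_{0}^{\infty}(B_{R}\setminus\{0\})$, $$\int_{B_{R}}V_{1}(|x|)\,|\Delta u|^{2}\,dx\geq\int_{B_{R}}W_{1}(|x|)\,|\nabla u|^{2}\,dx+(N-1)\int_{B_{R}}\left(\frac{V_{1}(|x|)}{|x|^{2}}-\frac{V_{1}'(|x|)}{|x|}\right)|\nabla u|^{2}\,dx.$$
   Context: $B_R$ is the open ball of radius $R$ centered at the origin in $\mathbb{R}^N$ (with $B_\infty=\mathbb{R}^N$). $C_0^\infty(\Omega)$ is the space of smooth functions with compact support in $\Omega$. For an integer $n\ge 1$, a pair $(V,W)$ of functions on $(0,R)$ (with $V\ge 0$ and $W$ of arbitrary sign) is an $n$-dimensional Bessel pair on $(0,R)$ if there exists a positive function $\varphi$ on $(0,R)$ such that $\left(r^{n-1}V\varphi'\right)'+r^{n-1}W\varphi=0$ on $(0,R)$. *)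

(* Defs.v *)
From HB Require Import structures.
From mathcomp Require Import all_boot all_order all_algebra.
From mathcomp Require Import all_classical all_reals all_analysis.

Set Implicit Arguments.
Unset Strict Implicit.
Unset Printing Implicit Defensive.

Import Order.TTheory GRing.Theory Num.Theory.
Import numFieldNormedType.Exports.

Local Open Scope ring_scope.
Local Open Scope classical_set_scope.

Section measurable_rV.
Context {R : realType} (n : nat).

Let coors : 'I_n -> 'rV[R]_n -> R := fun i x => x 0 i.

Let rV_set0 : g_sigma_preimage coors set0.
Proof. exact: sigma_algebra0. Qed.

Let rV_setC A : g_sigma_preimage coors A -> g_sigma_preimage coors (~` A).
Proof. exact: sigma_algebraC. Qed.

Let rV_bigcup (F : _^nat) : (forall i, g_sigma_preimage coors (F i)) ->
  g_sigma_preimage coors (\bigcup_i (F i)).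
Proof. exact: sigma_algebra_bigcup. Qed.

(* The product sigma-algebra on R^n; it is the Borel one. *)
HB.instance Definition _ :=
  @isMeasurable.Build (measure_tuple_display default_measure_display)
    'rV[R]_n (g_sigma_preimage coors) rV_set0 rV_setC rV_bigcup.

Lemma measurable_coord_rV (i : 'I_n) :
  measurable_fun [set: 'rV[R]_n] (fun x : 'rV[R]_n => x 0 i : R).
Proof.
move=> _ Y mY; rewrite setTI; apply: sub_sigma_algebra => /=.
rewrite -bigcup_seq/=; exists i => /=; first by rewrite mem_index_enum.
by exists Y => //; rewrite setTI.
Qed.

Lemma measurable_fun_rVP d (T : measurableType d) (f : T -> 'rV[R]_n) :
  (forall i, measurable_fun [set: T] (fun x => f x 0 i : R)) ->
  measurable_fun [set: T] f.
Proof.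
move=> mf _ A mA; rewrite setTI.
have : g_sigma_preimage (fun i => coors i \o f) `<=` measurable.
  apply: smallest_sub; first exact: sigma_algebra_measurable.
  move=> B; rewrite -bigcup_seq/= => -[i _ [C mC <-]].
  exact: mf.
rewrite g_sigma_preimage_comp; apply.
by exists A => //; rewrite setTI.
Qed.

End measurable_rV.

Definition cons_rV {R : realType} n (p : measurableTypeR R * 'rV[R]_n) :
    'rV[R]_n.+1 :=
  \row_i (if unlift ord0 i is Some j then p.2 0 j else p.1).

Definition uncons_rV {R : realType} n (x : 'rV[R]_n.+1) :
    measurableTypeR R * 'rV[R]_n :=
  (x 0 ord0, \row_j x 0 (lift ord0 j)).

Section cons_rV_theory.
Context {R : realType} (n : nat).

Lemma cons_rVK : cancel (@cons_rV R n) (@uncons_rV R n).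
Proof.
move=> [a x]; rewrite /uncons_rV mxE unlift_none; congr pair.
by apply/rowP => j; rewrite !mxE liftK.
Qed.

Lemma measurable_cons_rV : measurable_fun setT (@cons_rV R n).
Proof.
apply: measurable_fun_rVP => i.
rewrite (_ : (fun x => _) = fun p : measurableTypeR R * 'rV[R]_n =>
    if unlift ord0 i is Some j then p.2 0 j else p.1); last first.
  by apply/funext => p; rewrite mxE.
case: unlift => [j|]; last exact: measurable_fst.
apply: (@measurableT_comp _ _ _ _ _ _ (fun x : 'rV[R]_n => x 0 j)).
  exact: measurable_coord_rV.
exact: measurable_snd.
Qed.

Lemma measurable_uncons_rV : measurable_fun setT (@uncons_rV R n).
Proof.
apply/measurable_fun_pairP; split; first exact: measurable_coord_rV.
apply: measurable_fun_rVP => i /=.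
under eq_fun do rewrite mxE.
exact: measurable_coord_rV.
Qed.

End cons_rV_theory.

Section lebesgue_rV_rec.
Local Open Scope ereal_scope.
Context {R : realType} (n : nat).
Variable m : {sigma_finite_measure set 'rV[R]_n -> \bar R}.

Definition lebesgue_rVS : set 'rV[R]_n.+1 -> \bar R :=
  pushforward (lebesgue_measure \x m) (@cons_rV R n).

Let mcons A : measurable A -> measurable (@cons_rV R n @^-1` A).
Proof.
by move=> mA; rewrite -[X in measurable X]setTI; exact: measurable_cons_rV.
Qed.

Let lebesgue_rVS0 : lebesgue_rVS set0 = 0.
Proof. by rewrite /lebesgue_rVS /pushforward preimage_set0 measure0. Qed.

Let lebesgue_rVS_ge0 A : 0 <= lebesgue_rVS A.
Proof. exact: (measure_ge0 (lebesgue_measure \x m)). Qed.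

Let lebesgue_rVS_sigma_additive : semi_sigma_additive lebesgue_rVS.
Proof.
move=> F mF tF mUF; rewrite /lebesgue_rVS /pushforward preimage_bigcup.
apply: measure_semi_sigma_additive.
- by move=> i; exact: mcons.
- apply/trivIsetP => /= i j _ _ ij; rewrite -preimage_setI.
  by move/trivIsetP : tF => /(_ _ _ _ _ ij) ->//; rewrite preimage_set0.
- by rewrite -preimage_bigcup; exact: mcons.
Qed.

HB.instance Definition _ := isMeasure.Build _ _ _
  lebesgue_rVS lebesgue_rVS0 lebesgue_rVS_ge0 lebesgue_rVS_sigma_additive.

Let lebesgue_rVS_sigma_finite : sigma_finite setT lebesgue_rVS.
Proof.
have /sigma_finiteP[F [TF ndF Foo]] := sigma_finiteT (@lebesgue_measure R).
have /sigma_finiteP[G [TG ndG Goo]] := sigma_finiteT m.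
exists (fun k => @uncons_rV R n @^-1` (F k `*` G k)).
  apply/esym; rewrite -subTset => x _.
  have [k _ Fk] : (\bigcup_k F k) (uncons_rV x).1 by rewrite -TF.
  have [l _ Gl] : (\bigcup_k G k) (uncons_rV x).2 by rewrite -TG.
  exists (maxn k l) => //; split.
  - by move: Fk; exact/subsetPset/ndF/leq_maxl.
  - by move: Gl; exact/subsetPset/ndG/leq_maxr.
move=> k; have [mF Fk] := Foo k; have [mG Gk] := Goo k.
have mFG : measurable (F k `*` G k) by exact: measurableX.
split; first by rewrite -[X in measurable X]setTI; exact: measurable_uncons_rV.
rewrite /lebesgue_rVS /pushforward -comp_preimage.
rewrite (_ : @uncons_rV R n \o _ = id) ?preimage_id; last first.
  by apply/funext => p /=; rewrite cons_rVK.
by rewrite product_measure1E// lte_mul_pinfty// ge0_fin_numE.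
Qed.

HB.instance Definition _ := Measure_isSigmaFinite.Build _ _ _ lebesgue_rVS
  lebesgue_rVS_sigma_finite.

End lebesgue_rV_rec.

(* Lebesgue measure on R^n: the n-fold product of the one-dimensional Lebesgue
   measure; on R^0, a singleton, it is the unit point mass. *)
Fixpoint lebesgue_rV {R : realType} (n : nat) :
    {sigma_finite_measure set 'rV[R]_n -> \bar R} :=
  match n with
  | 0 => dirac (0 : 'rV[R]_0)
  | n'.+1 => lebesgue_rVS (lebesgue_rV n')
  end.

(* The norm `|x| of the library on 'rV[R]_n is the sup norm. *)
Definition enorm {R : realType} n (x : 'rV[R]_n) : R :=
  Num.sqrt (\sum_i x 0 i ^+ 2).

Definition eball {R : realType} n (rho : \bar R) : set 'rV[R]_n :=
  [set x | ((enorm x)%:E < rho)%E].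

Definition oitv0 {R : realType} (rho : \bar R) : set R :=
  [set r | 0 < r /\ (r%:E < rho)%E].

Definition partial {R : realType} n (i : 'I_n) (u : 'rV[R]_n -> R) :
    'rV[R]_n -> R :=
  'D_(delta_mx 0 i) u.

Definition iter_partial {R : realType} n (s : seq 'I_n) (u : 'rV[R]_n -> R) :
    'rV[R]_n -> R :=
  foldr (@partial R n) u s.

Definition grad {R : realType} n (u : 'rV[R]_n -> R) (x : 'rV[R]_n) :
    'rV[R]_n :=
  \row_i partial i u x.

Definition laplacian {R : realType} n (u : 'rV[R]_n -> R) (x : 'rV[R]_n) : R :=
  \sum_i partial i (partial i u) x.

Definition smooth_rV {R : realType} n (u : 'rV[R]_n -> R) : Prop :=
  forall s : seq 'I_n, continuous (iter_partial s u) /\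
    forall (i : 'I_n) (x : 'rV[R]_n),
      derivable (iter_partial s u) x (delta_mx 0 i).

(* A test function on the open set A is identified with its extension by zero,
   a smooth function on the whole space whose support is a compact subset
   of A. *)
Definition test_function {R : realType} n (A : set 'rV[R]_n)
    (u : 'rV[R]_n -> R) : Prop :=
  [/\ smooth_rV u,
      compact (closure [set x | u x != 0])
    & closure [set x | u x != 0] `<=` A].

(* Functions on the open set A of R are represented by total functions whose
   values outside A are irrelevant. *)
Definition smooth_on {R : realType} (A : set R) (f : R -> R) : Prop :=
  forall (k : nat) (r : R), A r -> derivable (derive1n k f) r 1.

(* The equation is understood in the classical sense: phi and r^(n-1) V phi'
   are differentiable at every point of (0, rho). *)
Definition bessel_pair {R : realType} (n : nat) (rho : \bar R)
    (V W : R -> R) : Prop :=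
  (forall r, oitv0 rho r -> 0 <= V r) /\
  exists phi : R -> R,
    let flux := fun t : R => t ^+ n.-1 * V t * derive1 phi t in
    forall r, oitv0 rho r ->
      [/\ 0 < phi r,
          derivable phi r 1,
          derivable flux r 1
        & derive1 flux r + r ^+ n.-1 * W r * phi r = 0].

(* Main.v *)
Require Import Defs.
From HB Require Import structures.
From mathcomp Require Import all_boot all_order all_algebra.
From mathcomp Require Import all_classical all_reals all_analysis.
From mathcomp Require Import measurable_realfun ring lra.

Set Implicit Arguments.
Unset Strict Implicit.
Unset Printing Implicit Defensive.

Import Order.TTheory GRing.Theory Num.Theory.
Import numFieldNormedType.Exports.

Local Open Scope ring_scope.
Local Open Scope classical_set_scope.

(** Notation: [x] is the point, [r = |x|], [p] the gradient of [u], [A] its Hessian,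
    [D] its Laplacian, [s = x.p], [P = 1 - x x^T / r^2] the projection onto the
    tangent space of the sphere through [x], [V = V1 r], [W = W1 r].

    No polar coordinates and no spherical harmonics are used: the integrand of
    the left-hand side minus those of the right-hand side is bounded below
    pointwise by a nonnegative function plus a sum of functions whose integral
    is nonnegative, mostly divergences of compactly supported vector fields with
    radial weights.  There are three ingredients.

    First, the Bessel pair is applied to each component [p_j] of the gradient
    rather than to modes of [u].  With [F = r^(n-1) V phi'], completing a square
    shows that [V (d_r p_j)^2 - W p_j^2] is at least the divergence of
    [(F / phi) p_j^2 x / r^n], so that [V |A x|^2 / r^2 - W |p|^2] has a
    nonnegative integral ([bessel_nonneg]).  As [phi] is only assumed
    differentiable, [phi'] may be discontinuous where [V] vanishes and the
    divergence need not be integrable; but each of the [n] partial derivatives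
    that make it up has a continuous upper bound, and this is enough for the
    one-sided integration by parts [ibp].

    Second, the Bochner identity for [V D^2 - V |A|^2] and the divergences of
    [(2 V / r^2 - V' / r) (s p - |p|^2 x)] turn the rest of the integrand into
    [C M / r^2 + V B / r^4 + V (|H|^2 - M) / r^4] ([energy_nonneg]).  Here
    [C = - V'' + 3 V' / r + (n - 5) V / r^2] is nonnegative by hypothesis,
    [M = r^2 |p|^2 - s^2] and [B = r^2 |A x + p|^2 - (x.(A x + p))^2] are
    nonnegative by Cauchy-Schwarz, and [H = r^2 P A P - s P] is the Hessian of
    the restriction of [u] to the sphere through [x], rescaled to radius 1.

    Third, the last term has a nonnegative integral ([tang_nonneg]): on every
    sphere the integral of [|H|^2 - M] is nonnegative, which amounts to the first
    nonzero eigenvalue of the unit sphere being at least [n - 1].  For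
    [n >= 3] this follows from the Bochner formula on the sphere, again in
    divergence form, and from [(tr H)^2 <= (n - 1) |H|^2].  For [n = 2] the
    latter inequality is an equality, and the term is
    [(d_theta^2 u)^2 - (d_theta u)^2]: the integral over a circle is nonnegative
    by Wirtinger's inequality, and averaging over the rotations of the plane
    reduces the integral over the plane to integrals over circles.  For [n = 1]
    the term is trivially nonnegative. *)

(** * Continuous functions with compact support on R^n *)

Lemma coord_le_norm (R : realType) n (x : 'rV[R]_n) i : `|x 0 i| <= `|x|.
Proof.
rewrite [leRHS]/Num.norm /= mx_normrE.
by apply/bigmax_geP; right => /=; exists (0, i).
Qed.

Lemma norm_le_coord (R : realType) n (x : 'rV[R]_n) (M : R) :
  0 <= M -> (forall i, `|x 0 i| <= M) -> `|x| <= M.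
Proof.
move=> M0 xM; rewrite /Num.norm /= mx_normrE; apply/bigmax_leP; split=> // -[a b] _ /=.
by rewrite ord1.
Qed.

Definition cont_compact {R : realType} n (f : 'rV[R]_n -> R) : Prop :=
  continuous f /\ exists M : R, forall x, M < `|x| -> f x = 0.

(** The product sigma-algebra contains the open sets because an open set is the
    union of the rational cubes that it contains. *)
Lemma open_measurable_rV (R : realType) n (U : set 'rV[R]_n) :
  open U -> measurable U.
Proof.
move=> oU.
pose box (qk : 'rV[rat]_n * nat) : set 'rV[R]_n :=
  [set x | forall i, `|ratr (qk.1 0 i) - x 0 i| < qk.2.+1%:R^-1].
have mbox qk : measurable (box qk).
  rewrite (_ : box qk = \bigcap_(i in [set: 'I_n])
      ((fun x : 'rV[R]_n => x 0 i : R) @^-1` [set a : R | `|ratr (qk.1 0 i) - a| < qk.2.+1%:R^-1])).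
    apply: fin_bigcap_measurable => // i _.
    rewrite -[X in measurable X]setTI.
    by apply: measurable_coord_rV => //; exact: (measurable_ball (ratr (qk.1 0 i)) qk.2.+1%:R^-1).
  by apply/seteqP; split => x /= xq i; [move=> _|]; apply: xq.
rewrite (_ : U = \bigcup_(qk in [set: 'rV[rat]_n * nat]) (if `[< box qk `<=` U >] then box qk else set0)).
  apply: countable_bigcupT_measurable; first exact: countableP.
  by move=> qk; case: asboolP.
apply/seteqP; split => [x Ux|x [qk _]]; last by case: asboolP => // /[apply].
have /nbhs_ballP[e /= e0 eU] : nbhs x U by apply: open_nbhs_nbhs.
have [k ke] : exists k : nat, k.+1%:R^-1 < e / 2.
  have e20 : 0 < e / 2 by rewrite divr_gt0.
  have := near_infty_natSinv_lt (PosNum e20).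
  by move=> [k _ kP]; exists k; exact: kP (leqnn k).
have qE i : exists q : rat, `|ratr q - x 0 i| < k.+1%:R^-1.
  have [|q] := @rat_in_itvoo R (x 0 i) (x 0 i + k.+1%:R^-1).
    by rewrite ltrDl invr_gt0.
  rewrite in_itv /= => /andP[q1 q2]; exists q.
  by rewrite ger0_norm ?subr_ge0 ?ltW// ltrBlDl.
have [q qP] := choice qE.
exists (\row_i q i, k) => //; rewrite asboolT /=; first by move=> i; rewrite mxE.
move=> y yq; apply: eU; split => // a i; rewrite ord1.
have := yq i; rewrite mxE => yi; rewrite /ball /=.
rewrite -(subrKA (ratr (q i))); apply: (le_lt_trans (ler_normD _ _)).
by rewrite (splitr e) ltrD// ?(lt_trans _ ke)// distrC.
Qed.

Lemma continuous_measurable_rV (R : realType) n (f : 'rV[R]_n -> R) :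
  continuous f -> measurable_fun setT f.
Proof.
move=> /continuousP cf; apply: (measurability _ (RGenOpens.measurableE R)).
move=> _ [_ [a [b ->] <-]]; rewrite setTI; apply: open_measurable_rV.
exact/cf/interval_open.
Qed.

Definition cube {R : realType} n (M : R) : set 'rV[R]_n :=
  [set x | forall i, `|x 0 i| <= M].
Arguments cube {R} n M.

Lemma measurable_cube (R : realType) n (M : R) :
  measurable (cube n M).
Proof.
rewrite (_ : cube n M = \bigcap_(i in [set: 'I_n])
    ((fun x : 'rV[R]_n => x 0 i : R) @^-1` `[- M, M])).
  apply: fin_bigcap_measurable => // i _.
  rewrite -[X in measurable X]setTI.
  exact: measurable_coord_rV.
apply/seteqP; split => x xq i.
  by move=> _ /=; rewrite in_itv /= -ler_norml; exact: xq.
by have := xq i I; rewrite /= in_itv /= -ler_norml.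
Qed.

Lemma lebesgue_rV_cube (R : realType) n (M : R) :
  (lebesgue_rV n (cube n M) < +oo)%E.
Proof.
elim: n => [|n IH]; first by rewrite /= diracE; case: (_ \in _); rewrite ltry.
rewrite /= /lebesgue_rVS /pushforward /=.
rewrite (_ : _ @^-1` _ =
    (`[- M, M]%classic : set (measurableTypeR R)) `*` cube n M).
  rewrite product_measure1E//; last exact: measurable_cube.
  apply: lte_mul_pinfty => //.
  rewrite ge0_fin_numE// /= lebesgue_measure_itv.
  by case: ifP => // _; rewrite -EFinD ltry.
apply/seteqP; split => [[a x] /= ax|[a x] /= [aM xM] i].
  split; first by have := ax ord0; rewrite mxE unlift_none in_itv /= ler_norml.
  by move=> i; have := ax (lift ord0 i); rewrite mxE liftK.
by rewrite mxE; case: unliftP => [j _|_] //=; move: aM; rewrite in_itv ler_norml.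
Qed.

Lemma cont_compact_bounded (R : realType) n (f : 'rV[R]_n -> R) :
  cont_compact f -> exists B, forall x, `|f x| <= B.
Proof.
move=> [cf [M fM]].
have cM : compact [set x : 'rV[R]_n | `|x| <= `|M|].
  apply: bounded_closed_compact.
    exists `|M|; split => // c Mc x /= xM; exact: le_trans xM (ltW Mc).
  rewrite (_ : [set _ | _] = (fun x : 'rV[R]_n => `|x|) @^-1` [set y | y <= `|M|]) //.
  apply: closed_comp; last exact: closed_le.
  by move=> x _; exact: norm_continuous.
have [|B [_ fB]] := compact_bounded (continuous_compact (f := f) _ cM).
  exact: continuous_subspaceT.
exists (`|B| + 1) => x.
have [xM|xM] := leP `|x| `|M|.
  by apply: (fB (`|B| + 1)); [rewrite ltr_pwDr// ler_norm|exists x].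
by rewrite fM ?normr0 ?addr_ge0//; apply: le_lt_trans xM; rewrite ler_norm.
Qed.

Lemma cont_compact_integrable (R : realType) n (f : 'rV[R]_n -> R) :
  cont_compact f -> (lebesgue_rV n).-integrable setT (EFin \o f).
Proof.
move=> ccf; have [cf [M fM]] := ccf.
have mB := @measurable_cube R n `|M|.
rewrite (_ : f = f \_ (cube n `|M|)).
  rewrite -restrict_EFin; apply/(integrable_restrict _ mB) => //; rewrite setTI.
  apply: measurable_bounded_integrable => //.
  - exact: lebesgue_rV_cube.
  - by apply: measurable_funTS; exact: continuous_measurable_rV.
  - have [B fB] := cont_compact_bounded ccf.
    exists B; split; first exact: num_real.
    by move=> c Bc x _ /=; exact: le_trans (fB x) (ltW Bc).
apply/funext => x; rewrite patchE; case: ifPn => // /negP xM; apply: fM.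
rewrite ltNge; apply/negP => xM'; apply: xM; rewrite inE /= => i.
apply: (le_trans (coord_le_norm _ _)); apply: (le_trans xM').
exact: ler_norm.
Qed.

(** * One-sided integration by parts *)

(** Directional derivatives only see the restriction of a function to a line;
    this moves them between different parametrizations of that line. *)
Lemma derive_line (R : numFieldType) (U V W : normedModType R)
    (F : U -> W) (G : V -> W) (a v : _) (b w : _) :
  (forall h : R, F (h *: v + a) = G (h *: w + b)) ->
  derivable G b w -> derivable F a v /\ 'D_v F a = 'D_w G b.
Proof.
move=> FG; have FG0 : F a = G b by have := FG 0; rewrite !scale0r !add0r.
rewrite /derivable /derive.
suff -> : (fun h : R => h^-1 *: ((F \o shift a) (h *: v) - F a)) =
          (fun h : R => h^-1 *: ((G \o shift b) (h *: w) - G b)) by [].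
by apply/funext => h /=; rewrite FG FG0.
Qed.

Lemma continuous_antiderivative (R : realType) (k : R -> R) (a : R) :
  continuous k -> exists K : R -> R, forall t, a < t -> is_derive t 1 K (k t).
Proof.
move=> ck; exists (fun x => \int[lebesgue_measure]_(t in `[a, x]) k t)%R => t at_.
have [||] := @continuous_FTC1_closed R k a t (t + 1) _ _ at_ (ck t).
- by rewrite ltrDl.
- apply: continuous_compact_integrable; first exact: segment_compact.
  exact: continuous_subspaceT.
- by move=> d e; rewrite -e derive1E; exact: derivableP.
Qed.

Lemma is_derive1_continuous (R : realType) (f : R -> R) (t df : R) :
  is_derive t 1 f df -> {for t, continuous f}.
Proof.
move=> [d _]; apply: differentiable_continuous.
exact/derivable1_diffP.
Qed.

Lemma integral_antiderivative (R : realType) (k K : R -> R) (a b : R) :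
  a < b -> continuous k -> (forall t, a <= t <= b -> is_derive t 1 K (k t)) ->
  (\int[lebesgue_measure]_(t in `[a, b]) (k t)%:E = (K b - K a)%:E)%E.
Proof.
move=> ab ck dK; rewrite (@continuous_FTC2 _ k K)//.
- exact: continuous_subspaceT.
- split.
  + by move=> t /[!in_itv]/= /andP[? ?]; apply: ex_derive; apply: dK; rewrite !ltW.
  + apply: cvg_at_right_filter; apply: is_derive1_continuous (dK a _).
    by rewrite lexx ltW.
  + apply: cvg_at_left_filter; apply: is_derive1_continuous (dK b _).
    by rewrite lexx ltW.
- move=> t /[!in_itv]/= /andP[? ?]; rewrite derive1E; apply: derive_val.
  by apply: dK; rewrite !ltW.
Qed.

Lemma nondecreasing_is_derive (R : realType) (f df : R -> R) (a b : R) :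
  a <= b -> (forall t, a <= t <= b -> is_derive t 1 f (df t)) ->
  (forall t, a <= t <= b -> 0 <= df t) -> f a <= f b.
Proof.
move=> ab d d0.
have [||c /[!in_itv]/= cab e] := @MVT_segment R f df a b ab.
- by move=> x /[!in_itv]/= /andP[? ?]; apply: d; rewrite !ltW.
- apply: continuous_in_subspaceT => x; rewrite inE /= in_itv /= => /d.
  exact: is_derive1_continuous.
- by rewrite -subr_ge0 e mulr_ge0 ?subr_ge0 ?d0.
Qed.

(** An antiderivative of [k] minus [G] is nondecreasing by the mean value theorem,
    which applies to derivatives that are not integrable, and [G] vanishes at both
    ends. *)
Lemma ibp1 (R : realType) (G k : R -> R) (M : R) :
  continuous k -> (forall t, M < `|t| -> G t = 0) ->
  (forall t, M < `|t| -> k t = 0) ->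
  (forall t, derivable G t 1) -> (forall t, 'D_1 G t <= k t) ->
  (0 <= \int[lebesgue_measure]_t (k t)%:E)%E.
Proof.
move=> ck G0 k0 dG Gk.
pose b : R := `|M| + 1.
have b0 : 0 < b by rewrite /b ltr_pwDr.
have Mb : M < b by rewrite /b ltr_pwDr// ler_norm.
have [K dK] := continuous_antiderivative (- b - 1) ck.
have dK' (t : R) : - b <= t <= b -> is_derive t 1 K (k t).
  move=> /andP[tb _]; apply: dK; apply: lt_le_trans tb.
  by rewrite ltrBlDr ltrDl.
rewrite (_ : (\int[_]_t _ = \int[lebesgue_measure]_(t in `[(- b)%R, b]) (k t)%:E)%E).
  rewrite (integral_antiderivative (K := K)) ?gtrN// lee_fin subr_ge0.
  pose S : R -> R := K - G.
  have := @nondecreasing_is_derive R S (fun t => k t - 'D_1 G t) (- b) b.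
  have -> : S (- b) = K (- b).
    by rewrite /S !fctE G0 ?subr0// normrN gtr0_norm.
  have -> : S b = K b by rewrite /S !fctE G0 ?subr0// gtr0_norm.
  apply.
  - by rewrite ge0_cp// ltW.
  - by move=> t tb; apply: is_deriveB; [exact: dK'|exact: derivableP].
  - by move=> t _; rewrite subr_ge0.
rewrite [RHS]integral_mkcond; apply: eq_integral => t _.
rewrite patchE; case: ifPn => // /negP tb; rewrite k0//.
rewrite ltNge; apply/negP => tM; apply: tb; rewrite inE /= in_itv /= -ler_norml.
by rewrite (le_trans tM)// ltW.
Qed.

Section cons_rV_lemmas.
Context {R : realType} (n : nat).

Lemma cons_rV_line0 (h a : R) (y : 'rV[R]_n) :
  cons_rV (h *: 1 + a, y) = h *: delta_mx 0 ord0 + cons_rV (a, y).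
Proof.
apply/rowP => i; rewrite !mxE /= ?eqxx /=.
case: unliftP => [j ->|->]; last by rewrite eqxx mulr1 /GRing.scale /= mulr1.

by rewrite eq_sym (negbTE (neq_lift _ _)) mulr0 add0r.
Qed.

Lemma cons_rV_line (h a : R) (y : 'rV[R]_n) j :
  cons_rV (a, h *: delta_mx 0 j + y) =
  h *: delta_mx 0 (lift ord0 j) + cons_rV (a, y).
Proof.
apply/rowP => i; rewrite !mxE /= ?eqxx /=.
case: unliftP => [l ->|->]; last first.
  by rewrite (negbTE (neq_lift _ _)) mulr0 add0r.
by rewrite !mxE eqxx /= (inj_eq (@lift_inj _ _)).
Qed.

Lemma coord_cvg_rV (T : Type) (F : set_system T) {FF : Filter F} m
    (f : T -> 'rV[R]_m) (l : 'rV[R]_m) :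
  (forall i, f t 0 i @[t --> F] --> l 0 i) -> f t @[t --> F] --> l.
Proof.
move=> fl; apply/cvgrPdist_lt => e e0.
have e20 : 0 < e / 2 by rewrite divr_gt0.
have : \forall t \near F, forall i, `|l 0 i - f t 0 i| < e / 2.
  apply: filter_forall => i.
  by move/cvgrPdist_lt : (fl i); exact.
apply: filterS => t H; apply: (@le_lt_trans _ _ (e / 2)).
  by apply: norm_le_coord; [exact: ltW|move=> i; rewrite !mxE ltW].
by rewrite ltr_pdivrMr// mulr_natr mulr2n ltrDl.
Qed.

Lemma continuous_cons_rVl (y : 'rV[R]_n) : continuous (fun a : R => cons_rV (a, y)).
Proof.
move=> a; apply: (@coord_cvg_rV _ (nbhs a)) => i.
under eq_fun do rewrite mxE /=.
by rewrite mxE /=; case: unlift => [j|]; [exact: cvg_cst|exact: cvg_id].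
Qed.

Lemma continuous_cons_rVr (a : R) :
  continuous (fun y : 'rV[R]_n => cons_rV (a, y)).
Proof.
move=> y; apply: (@coord_cvg_rV _ (nbhs y)) => i.
under eq_fun do rewrite mxE /=.
rewrite mxE /=; case: unlift => [j|]; last exact: cvg_cst.
exact: coord_continuous.
Qed.

Lemma cons_rV_norm_gel (a : R) (y : 'rV[R]_n) : `|a| <= `|cons_rV (a, y)|.
Proof. by have := coord_le_norm (cons_rV (a, y)) ord0; rewrite mxE unlift_none. Qed.

Lemma cons_rV_norm_ger (a : R) (y : 'rV[R]_n) : `|y| <= `|cons_rV (a, y)|.
Proof.
apply: norm_le_coord => // j.
by have := coord_le_norm (cons_rV (a, y)) (lift ord0 j); rewrite mxE liftK.
Qed.

End cons_rV_lemmas.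

Section fubini_rV.
Context {R : realType} (n : nat) (f : 'rV[R]_n.+1 -> R).
Hypothesis ccf : cont_compact f.

Let mf : measurable_fun setT (EFin \o f).
Proof. by apply/measurable_EFinP; apply: continuous_measurable_rV; case: ccf. Qed.

Let intf : (lebesgue_measure \x lebesgue_rV n)%E.-integrable setT
  ((EFin \o f) \o @cons_rV R n).
Proof.
have /integrableP[_ foo] := cont_compact_integrable ccf.
apply/integrableP; split.
  by apply: measurableT_comp => //; exact: measurable_cons_rV.
move: foo; rewrite /= /lebesgue_rVS.
rewrite ge0_integral_pushforward//=.
- exact: measurable_cons_rV.
apply/measurable_EFinP; apply: continuous_measurable_rV => x.
by apply: continuous_comp; [case: ccf => + _; exact|exact: norm_continuous].
Qed.

Let push : (\int[lebesgue_rV n.+1]_x (f x)%:E =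
  \int[lebesgue_measure \x lebesgue_rV n]_p (f (cons_rV p))%:E)%E.
Proof.
rewrite /= /lebesgue_rVS (@integral_pushforward _ _ _ _ _ _ _ _ setT (EFin \o f))//.
exact: measurable_cons_rV.
Qed.

Lemma integral_rVS12 : (\int[lebesgue_rV n.+1]_x (f x)%:E =
  \int[lebesgue_measure]_a \int[lebesgue_rV n]_y (f (cons_rV (a, y)))%:E)%E.
Proof. by rewrite push -(integral12_prod_meas1 intf). Qed.

Lemma integral_rVS21 : (\int[lebesgue_rV n.+1]_x (f x)%:E =
  \int[lebesgue_rV n]_y \int[lebesgue_measure]_a (f (cons_rV (a, y)))%:E)%E.
Proof. by rewrite push -(integral21_prod_meas1 intf). Qed.

End fubini_rV.

Lemma cont_compact_cons_rV (R : realType) n (f : 'rV[R]_n.+1 -> R) (a : R) :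
  cont_compact f -> cont_compact (fun y : 'rV[R]_n => f (cons_rV (a, y))).
Proof.
move=> [cf [M fM]]; split.
  by move=> y; apply: continuous_comp; [exact: continuous_cons_rVr|exact: cf].
by exists M => y yM; apply: fM; apply: lt_le_trans yM (cons_rV_norm_ger _ _).
Qed.

(** Fubini's theorem reduces this to the one-dimensional case along the [i]-th
    coordinate.  The derivative of [G] is only bounded above by the continuous
    function [k]: this is what allows fluxes that are differentiable but not
    continuously so. *)
Lemma ibp (R : realType) n (i : 'I_n) (G k : 'rV[R]_n -> R) (M : R) :
  cont_compact k -> (forall x, M < `|x| -> G x = 0) ->
  (forall x, derivable G x (delta_mx 0 i)) ->
  (forall x, 'D_(delta_mx 0 i) G x <= k x) ->
  (0 <= \int[lebesgue_rV n]_x (k x)%:E)%E.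
Proof.
elim: n i G k => [[]//|n IH] i G k cck G0 dG Gk.
have [ck [Mk k0]] := cck.
case: (unliftP ord0 i) => [j ij|i0].
  rewrite integral_rVS12//; apply: integral_ge0 => a _.
  have dl y := @derive_line R _ _ _ (fun y => G (cons_rV (a, y))) G
    y (delta_mx 0 j) _ (delta_mx 0 (lift ord0 j))
    (fun h => congr1 G (cons_rV_line h a y j)).
  apply: (IH j (fun y => G (cons_rV (a, y)))).
  - exact: cont_compact_cons_rV.
  - by move=> y yM; apply: G0; apply: lt_le_trans yM (cons_rV_norm_ger _ _).
  - by move=> y; have [] := dl y; rewrite -?ij.
  - by move=> y; have [|_ ->] := dl y; rewrite -?ij.
rewrite integral_rVS21//; apply: integral_ge0 => y _.
have dl a := @derive_line R R^o _ _ (fun a => G (cons_rV (a, y))) G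
    a 1 _ (delta_mx 0 ord0) (fun h => congr1 G (cons_rV_line0 h a y)).
apply: (@ibp1 R (fun a => G (cons_rV (a, y))) _ (Num.max M Mk)).
- move=> a; apply: continuous_comp; [exact: continuous_cons_rVl|exact: ck].
- move=> a; rewrite gt_max => /andP[aM _]; apply: G0.
  by apply: lt_le_trans aM (cons_rV_norm_gel _ _).
- move=> a; rewrite gt_max => /andP[_ aM]; apply: k0.
  by apply: lt_le_trans aM (cons_rV_norm_gel _ _).
- by move=> a; have [] := dl a; rewrite -?i0.
- by move=> a; have [|_ ->] := dl a; rewrite -?i0.
Qed.

(** * Continuously differentiable functions *)

Section continuous_pointwise.
Context {R : realType} {T : topologicalType}.
Implicit Types f g : T -> R.

Lemma contD f g : continuous f -> continuous g -> continuous (fun x => f x + g x).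
Proof. by move=> cf cg x; apply: (@continuousD R R^o T f g); [exact: cf|exact: cg]. Qed.

Lemma contN f : continuous f -> continuous (fun x => - f x).
Proof. by move=> cf x; apply: (@continuousN R R^o T f); exact: cf. Qed.

Lemma contB f g : continuous f -> continuous g -> continuous (fun x => f x - g x).
Proof. by move=> cf cg; apply: contD => //; exact: contN. Qed.

Lemma contM f g : continuous f -> continuous g -> continuous (fun x => f x * g x).
Proof. by move=> cf cg x; apply: (@continuousM R T f g); [exact: cf|exact: cg]. Qed.

Lemma cont_cst (a : R) : continuous (fun _ : T => a).
Proof. exact: cst_continuous. Qed.

Lemma cont_sum m (F : 'I_m -> T -> R) : (forall j, continuous (F j)) ->
  continuous (fun x => \sum_j F j x).
Proof.
elim: m F => [|m IH] F cF.
  by under eq_fun do rewrite big_ord0; exact: cont_cst.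
under eq_fun do rewrite big_ord_recl.
by apply: contD => //; apply: IH.
Qed.

End continuous_pointwise.

Section c1.
Context {R : realType} (n : nat).
Implicit Types (f g : 'rV[R]_n -> R) (x : 'rV[R]_n).

Definition c1 f : Prop := [/\ continuous f,
  forall i x, derivable f x (delta_mx 0 i) & forall i, continuous (partial i f)].

Lemma c1_continuous f : c1 f -> continuous f. Proof. by case. Qed.

Lemma c1_derivable f i x : c1 f -> derivable f x (delta_mx 0 i).
Proof. by case. Qed.

Lemma partial_is_derive f i x : c1 f -> is_derive x (delta_mx 0 i) f (partial i f x).
Proof. by move=> cf; apply: derivableP; exact: c1_derivable. Qed.

Lemma c1_is_derive f (df : 'I_n -> 'rV[R]_n -> R) : continuous f ->
  (forall i x, is_derive x (delta_mx 0 i) f (df i x)) ->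
  (forall i, continuous (df i)) ->
  c1 f /\ forall i x, partial i f x = df i x.
Proof.
move=> cf d cd.
have e i x : partial i f x = df i x by apply: derive_val.
split=> //; split => // i; rewrite (_ : partial i f = df i) //; exact/funext.
Qed.

Lemma c1_cst (a : R) : c1 (fun=> a) /\ forall i x, partial i (fun=> a) x = 0.
Proof.
by apply: (c1_is_derive (df := fun _ _ => 0)) => [|i]; exact: cst_continuous.
Qed.

Lemma c1_coord j : c1 (fun x => x 0 j) /\
  forall i x, partial i (fun x => x 0 j) x = (i == j)%:R.
Proof.
apply: (c1_is_derive (df := fun i _ => (i == j)%:R)) => [|i x|i].
- exact: coord_continuous.
- have H : is_derive (0 : R) (1 : R) (fun h => h * (i == j)%:R + x 0 j) ((i == j)%:R).
    apply: is_derive_eq; rewrite /GRing.scale /= mulr0 addr0 mulr1 add0r; ring.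
  have [|H1 H2] := @derive_line R _ R^o R^o (fun x => x 0 j)
    (fun h => h * (i == j)%:R + x 0 j) x (delta_mx 0 i) 0 1 _ (@ex_derive _ _ _ _ _ _ _ H).
    by move=> h; rewrite !mxE eqxx /= addr0 /GRing.scale /= mulr1 eq_sym.
  by apply: DeriveDef => //; rewrite H2; exact: derive_val.
- exact: cst_continuous.
Qed.

Lemma c1D f g : c1 f -> c1 g -> c1 (fun x => f x + g x) /\
  forall i x, partial i (fun x => f x + g x) x = partial i f x + partial i g x.
Proof.
move=> cf cg; apply: (c1_is_derive (df := fun i x => partial i f x + partial i g x)).
- by move=> x; apply: continuousD; apply: c1_continuous.
- by move=> i x; apply: is_deriveD; exact: partial_is_derive.
- by move=> i x; apply: continuousD; [case: cf|case: cg] => _ _; exact.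
Qed.

Lemma c1N f : c1 f -> c1 (fun x => - f x) /\
  forall i x, partial i (fun x => - f x) x = - partial i f x.
Proof.
move=> cf; apply: (c1_is_derive (df := fun i x => - partial i f x)).
- by move=> x; apply: continuousN; apply: c1_continuous.
- by move=> i x; apply: is_deriveN; exact: partial_is_derive.
- by move=> i x; apply: continuousN; case: cf => _ _; exact.
Qed.

Lemma c1M f g : c1 f -> c1 g -> c1 (fun x => f x * g x) /\
  forall i x, partial i (fun x => f x * g x) x =
    partial i f x * g x + f x * partial i g x.
Proof.
move=> cf cg.
apply: (c1_is_derive (df := fun i x => partial i f x * g x + f x * partial i g x)).
- by move=> x; apply: continuousM; apply: c1_continuous.
- move=> i x.
  have := is_deriveM (partial_is_derive i x cf) (partial_is_derive i x cg).
  by rewrite addrC /GRing.scale /= [g x * _]mulrC.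
- move=> i; apply: contD; apply: contM; try exact: c1_continuous.
  + by case: cf => _ _; exact.
  + by case: cg => _ _; exact.
Qed.

Lemma c1_sum m (F : 'I_m -> 'rV[R]_n -> R) : (forall j, c1 (F j)) ->
  c1 (fun x => \sum_j F j x) /\
  forall i x, partial i (fun x => \sum_j F j x) x = \sum_j partial i (F j) x.
Proof.
elim: m F => [|m IH] F cF.
  have [h1 h2] := c1_cst 0.
  rewrite (_ : (fun x => _) = fun=> 0); last by apply/funext => x; rewrite big_ord0.
  by split => // i x; rewrite big_ord0.
have [h1 h2] := IH (fun j => F (lift ord0 j)) (fun j => cF _).
have [h3 h4] := c1D (cF ord0) h1.
rewrite (_ : (fun x => \sum_j F j x) =
  fun x => F ord0 x + \sum_(j < m) F (lift ord0 j) x); last first.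
  by apply/funext => x; rewrite big_ord_recl.
by split => // i x; rewrite h4 h2 big_ord_recl.
Qed.

End c1.

(** * Symmetry of second derivatives, supports, radial functions *)

Section smooth.
Context {R : realType} (n : nat).
Implicit Types (f u : 'rV[R]_n -> R) (x : 'rV[R]_n).

Lemma smooth_c1 u (s : seq 'I_n) : smooth_rV u -> c1 (iter_partial s u).
Proof.
move=> su; split; first exact: (su s).1.
  by move=> i x; exact: (su s).2.
by move=> i; exact: (su (i :: s)).1.
Qed.

Lemma MVT_partial f i x (t : R) : 0 < t ->
  (forall y, derivable f y (delta_mx 0 i)) ->
  exists2 c : R, 0 <= c <= t &
  f (t *: delta_mx 0 i + x) - f x = t * partial i f (c *: delta_mx 0 i + x).
Proof.
move=> t0 df.
have dF (c : R) : is_derive c 1 (fun h : R => f (h *: delta_mx 0 i + x))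
    (partial i f (c *: delta_mx 0 i + x)).
  have [|H1 H2] := @derive_line R R^o _ _ (fun h : R => f (h *: delta_mx 0 i + x)) f
    c 1 (c *: delta_mx 0 i + x) (delta_mx 0 i) _ (df _).
    by move=> h; rewrite scalerDl addrA /GRing.scale /= mulr1.
  exact: DeriveDef.
have [|c /[!in_itv]/= cI] := @MVT_segment R (fun h : R => f (h *: delta_mx 0 i + x))
  (fun c => partial i f (c *: delta_mx 0 i + x)) 0 t (ltW t0).
- by apply: continuous_subspaceT => c; exact: is_derive1_continuous (dF c).
- by rewrite scale0r add0r subr0 => ->; exists c => //; rewrite mulrC.
Qed.

(** Two applications of the mean value theorem to a second difference. *)
Lemma schwarz_mvt u i j x (t : R) : 0 < t -> 
  (forall y, derivable u y (delta_mx 0 i)) ->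
  (forall y, derivable (partial i u) y (delta_mx 0 j)) ->
  exists2 z, `|z - x| <= t + t &
  (u (t *: delta_mx 0 i + (t *: delta_mx 0 j + x)) - u (t *: delta_mx 0 j + x)) -
  (u (t *: delta_mx 0 i + x) - u x) = t * (t * partial j (partial i u) z).
Proof.
move=> t0 di dji.
have dF y : is_derive y (delta_mx 0 i) (fun y => u (t *: delta_mx 0 j + y) - u y)
   (partial i u (t *: delta_mx 0 j + y) - partial i u y).
  apply: is_deriveB; last exact: derivableP.
  have [|H1 H2] := @derive_line R _ _ _ (fun y => u (t *: delta_mx 0 j + y)) u
    y (delta_mx 0 i) (t *: delta_mx 0 j + y) (delta_mx 0 i) _ (di _).
    by move=> h; rewrite addrCA.
  exact: DeriveDef.
have [|c /andP[c0 ct] e] := @MVT_partial (fun y => u (t *: delta_mx 0 j + y) - u y) i x t t0.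
  by move=> y; exact: ex_derive.
have [d /andP[d0 dt] e'] := @MVT_partial (partial i u) j (c *: delta_mx 0 i + x) t t0 dji.
exists (d *: delta_mx 0 j + (c *: delta_mx 0 i + x)).
  rewrite addrA addrK; apply: (le_trans (ler_normD _ _)).
  have H (k : 'I_n) : `|(delta_mx 0 k : 'rV[R]_n)| <= 1.
    by apply: norm_le_coord => // l; rewrite mxE; case: (_ && _); rewrite ?normr1 ?normr0.
  rewrite !normrZ !ger0_norm//; apply: lerD.
    by rewrite -[leRHS]mulr1; apply: ler_pM.
  by rewrite -[leRHS]mulr1; apply: ler_pM.
rewrite -e'.
have -> : partial i u (t *: delta_mx 0 j + (c *: delta_mx 0 i + x)) - partial i u (c *: delta_mx 0 i + x)
  = partial i (fun y => u (t *: delta_mx 0 j + y) - u y) (c *: delta_mx 0 i + x).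
  by apply: esym; apply: derive_val.
by rewrite -e [X in u X - _]addrCA; ring.
Qed.

(** The second difference of [u] on a small square is the square of the side times
    either mixed derivative, taken at some point of the square. *)
Lemma schwarz u i j : (forall k y, derivable u y (delta_mx 0 k)) ->
  (forall k l y, derivable (partial k u) y (delta_mx 0 l)) ->
  (forall k l, continuous (partial k (partial l u))) ->
  partial i (partial j u) = partial j (partial i u).
Proof.
move=> d1 d2 c2; apply/funext => x; apply/eqP; rewrite -subr_eq0 -normr_le0.
apply/ler_addgt0Pr => /= e e0; rewrite add0r.
have e20 : 0 < e / 2 by rewrite divr_gt0.
have near_bound k l : \forall y \near x, `|partial k (partial l u) x - partial k (partial l u) y| < e / 2.
  by have /cvgrPdist_lt/(_ _ e20) := c2 k l x.
have : \forall y \near x, `|partial i (partial j u) x - partial i (partial j u) y| < e / 2 /\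
    `|partial j (partial i u) x - partial j (partial i u) y| < e / 2.
  exact: filterI (near_bound i j) (near_bound j i).
move=> /nbhs_ballP[r /= r0 rP].
pose t := r / 4.
have t0 : 0 < t by rewrite divr_gt0.
have tr : t + t < r by rewrite /t; lra.
have inball z : `|z - x| <= t + t -> ball x r z.
  by rewrite -ball_normE /ball_ /= distrC => /le_lt_trans; apply.
have [z1 z1x e1] := @schwarz_mvt u i j x t t0 (d1 i) (d2 i j).
have [z2 z2x e2] := @schwarz_mvt u j i x t t0 (d1 j) (d2 j i).
have z12 : partial j (partial i u) z1 = partial i (partial j u) z2.
  have : t * (t * partial j (partial i u) z1) = t * (t * partial i (partial j u) z2).
    have cE : t *: delta_mx 0 j + (t *: delta_mx 0 i + x) =
              t *: delta_mx 0 i + (t *: delta_mx 0 j + x) by rewrite addrCA.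
    move: e1 e2; rewrite cE.
    move: (u _) (u _) (u _) (u _) (partial j _ _) (partial i _ _) => a b c d p q.
    by move=> <- <-; ring.
  by move=> /(mulfI (lt0r_neq0 t0)) /(mulfI (lt0r_neq0 t0)).
have [_ h1] := rP _ (inball _ z1x).
have [h2 _] := rP _ (inball _ z2x).
rewrite -(subrKA (partial i (partial j u) z2)) -{2}z12.
apply: (le_trans (ler_normD _ _)); rewrite [e]splitr; apply: lerD; first exact: ltW h2.
by rewrite distrC; exact: ltW h1.
Qed.

Lemma iter_partial_schwarz u i j s : smooth_rV u ->
  iter_partial [:: i, j & s] u = iter_partial [:: j, i & s] u.
Proof.
move=> su; apply: schwarz => [k y|k l y|k l].
- exact: (su s).2.
- exact: (su (k :: s)).2.
- exact: (su [:: k, l & s]).1.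
Qed.

Definition supported (K : set 'rV[R]_n) f := forall x, ~ K x -> f x = 0.

Lemma supported_partial K f i : closed K -> supported K f -> supported K (partial i f).
Proof.
move=> cK sf x Kx; rewrite /partial.
rewrite (@near_eq_derive _ _ _ f (cst 0)); first exact: derive_cst.
have : nbhs x (~` K) by apply: open_nbhs_nbhs; split => //; exact: closed_openC.
by apply: filterS => y; exact: sf.
Qed.

Lemma supported_iter_partial u s :
  supported (closure [set x | u x != 0]) (iter_partial s u).
Proof.
elim: s => [|i s IH] /=; last exact/supported_partial/IH/closed_closure.
move=> x ux; apply/eqP; apply: contra_notT ux => ux; exact: subset_closure.
Qed.

Lemma supported_norm K f : compact K -> supported K f ->
  exists M : R, forall x, M < `|x| -> f x = 0.
Proof.
move=> cK sf; have [M [_ KM]] := compact_bounded cK.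
exists (`|M| + 1) => x xM; apply: sf => Kx.
have := KM (`|M| + 1); rewrite ltr_pwDr ?ler_norm// => /(_ isT x Kx) /=.
by rewrite leNgt xM.
Qed.

End smooth.

Section radial.
Context {R : realType} (n : nat).
Implicit Types (f : 'rV[R]_n -> R) (x : 'rV[R]_n) (g dg : R -> R).

Lemma enorm_ge0 x : 0 <= enorm x. Proof. exact: sqrtr_ge0. Qed.

Lemma enorm_sqr x : enorm x ^+ 2 = \sum_i x 0 i ^+ 2.
Proof. by rewrite sqr_sqrtr//; apply: sumr_ge0 => i _; exact: sqr_ge0. Qed.

Lemma enorm_eq0 x : (enorm x == 0) = (x == 0).
Proof.
apply/eqP/eqP => [x0|->]; last first.
  apply/eqP; rewrite -sqrf_eq0 enorm_sqr big1 // => i _.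
  by rewrite mxE expr0n.
have : \sum_i x 0 i ^+ 2 = 0 by rewrite -enorm_sqr x0 expr0n.
move/eqP; rewrite psumr_eq0 => [/allP H|i _]; last exact: sqr_ge0.
apply/rowP => i; apply/eqP; rewrite mxE -sqrf_eq0.
by apply: H; rewrite mem_index_enum.
Qed.

Lemma continuous_enorm : continuous (@enorm R n).
Proof.
move=> x; apply: (@continuous_comp _ _ _ (fun x : 'rV[R]_n => \sum_i x 0 i ^+ 2) Num.sqrt).
  apply: cont_sum => i; under eq_fun do rewrite expr2.
  by apply: contM; exact: coord_continuous.
exact: sqrt_continuous.
Qed.

(** On the line through [x] in direction [e_i] the squared norm is the quadratic
    polynomial [q]. *)
Lemma is_derive_radial g dg i x : x != 0 ->
  is_derive (enorm x) 1 g (dg (enorm x)) ->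
  is_derive x (delta_mx 0 i) (fun y => g (enorm y)) (dg (enorm x) * (x 0 i / enorm x)).
Proof.
move=> x0 Dg.
have r0 : 0 < enorm x by rewrite lt_def enorm_ge0 enorm_eq0 x0.
pose q (h : R) : R := h * h + 2 * x 0 i * h + enorm x ^+ 2.
have line h : enorm (h *: delta_mx 0 i + x) = Num.sqrt (q h).
  rewrite /enorm /q -/(enorm x) enorm_sqr; congr Num.sqrt.
  rewrite (bigD1 i)//= [in RHS](bigD1 i)//= !mxE !eqxx mulr1.
  rewrite (eq_bigr (fun j => x 0 j ^+ 2)); first by ring.
  by move=> j ji; rewrite !mxE (negbTE ji) andbF mulr0 add0r.
have q0 : q 0 = enorm x ^+ 2 by rewrite /q !mulr0 !add0r.
have dq : is_derive (0 : R) 1 q (2 * x 0 i).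
  apply: is_derive_eq; rewrite /GRing.scale /=; ring.
have ds : is_derive (q 0) 1 Num.sqrt (2 * Num.sqrt (q 0))^-1.
  by apply: is_derive1_sqrt; rewrite q0 exprn_gt0.
have sq0 : Num.sqrt (q 0) = enorm x by rewrite q0 sqrtr_sqr ger0_norm // ltW.
have dsq : is_derive (0 : R) 1 (Num.sqrt \o q) (x 0 i / enorm x).
  have := is_derive1_comp ds dq; rewrite sq0 /GRing.scale /=.
  rewrite (_ : _ * _ = x 0 i / enorm x)//; field.
  by rewrite lt0r_neq0.
have dgc : is_derive (0 : R) 1 (g \o (Num.sqrt \o q)) (dg (enorm x) * (x 0 i / enorm x)).
  have Dg' : is_derive ((Num.sqrt \o q) 0) 1 g (dg (enorm x)) by rewrite /= sq0.
  by have := is_derive1_comp Dg' dsq; rewrite /GRing.scale.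
have [|H1 H2] := @derive_line R _ R^o _ (fun y => g (enorm y))
    (g \o (Num.sqrt \o q)) x (delta_mx 0 i) 0 1 _ (@ex_derive _ _ _ _ _ _ _ dgc).
  by move=> h; rewrite line addr0 /GRing.scale /= mulr1.
by apply: DeriveDef => //; rewrite H2; exact: derive_val.
Qed.

End radial.

(** * Divergences with radial weights *)

Section nonneg_integral.
Context {R : realType} (n : nat).
Implicit Types (f g : 'rV[R]_n -> R).

(** The proof of the main inequality adds up members of this class, which is closed
    under sums and upper bounds. *)
Definition nonneg_integral f : Prop :=
  cont_compact f /\ (0 <= \int[lebesgue_rV n]_x (f x)%:E)%E.

Lemma cont_compactD f g : cont_compact f -> cont_compact g -> cont_compact (fun x => f x + g x).
Proof.
move=> [cf [M fM]] [cg [M' gM]]; split; first exact: contD.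
exists (Num.max M M') => x; rewrite gt_max => /andP[xM xM'].
by rewrite fM// gM// addr0.
Qed.

Lemma cont_compactMl f g : continuous f -> cont_compact g -> cont_compact (fun x => f x * g x).
Proof.
move=> cf [cg [M gM]]; split; first exact: contM.
by exists M => x xM; rewrite gM// mulr0.
Qed.

Lemma cont_compactN f : cont_compact f -> cont_compact (fun x => - f x).
Proof.
move=> [cf [M fM]]; split; first exact: contN.
by exists M => x xM; rewrite fM// oppr0.
Qed.

Lemma cont_compact0 : cont_compact (fun _ : 'rV[R]_n => 0 : R).
Proof. by split; [exact: cont_cst|exists 0]. Qed.

Lemma integral_cont_compactD f g : cont_compact f -> cont_compact g ->
  (\int[lebesgue_rV n]_x (f x + g x)%:E =
   \int[lebesgue_rV n]_x (f x)%:E + \int[lebesgue_rV n]_x (g x)%:E)%E.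
Proof.
move=> cf cg; by rewrite -integralD//; [exact: cont_compact_integrable cf|exact: cont_compact_integrable cg].
Qed.

Lemma nonneg_integralD f g : nonneg_integral f -> nonneg_integral g ->
  nonneg_integral (fun x => f x + g x).
Proof.
move=> [cf f0] [cg g0]; split; first exact: cont_compactD.
by rewrite integral_cont_compactD// adde_ge0.
Qed.

Lemma nonneg_integral_ge0 f : cont_compact f -> (forall x, 0 <= f x) -> nonneg_integral f.
Proof. by move=> cf f0; split => //; apply: integral_ge0 => x _; rewrite lee_fin. Qed.

Lemma nonneg_integral_eq f g : f =1 g -> nonneg_integral f -> nonneg_integral g.
Proof. by move=> /funext ->. Qed.

Lemma nonneg_integral_le f g : nonneg_integral f -> cont_compact g -> (forall x, f x <= g x) ->
  nonneg_integral g.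
Proof.
move=> nf cg fg.
have cd : cont_compact (fun x => g x - f x) by apply: cont_compactD => //; apply: cont_compactN; case: nf.
have d0 x : 0 <= g x - f x by rewrite subr_ge0.
apply: nonneg_integral_eq (nonneg_integralD nf (nonneg_integral_ge0 cd d0)) => x.
by rewrite addrCA subrr addr0.
Qed.

Lemma nonneg_integral_sum m (F : 'I_m -> 'rV[R]_n -> R) :
  (forall j, nonneg_integral (F j)) -> nonneg_integral (fun x => \sum_j F j x).
Proof.
elim: m F => [|m IH] F cF.
  under eq_fun do rewrite big_ord0.
  by apply: nonneg_integral_ge0; first exact: cont_compact0.
under eq_fun do rewrite big_ord_recl.
by apply: nonneg_integralD => //; apply: IH.
Qed.

End nonneg_integral.

Section radial_ibp.
Context {R : realType} (n : nat) (rho : \bar R) (K : set 'rV[R]_n).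
Implicit Types (f b k : 'rV[R]_n -> R) (x : 'rV[R]_n) (g dg : R -> R).
Hypothesis cK : compact K.
Hypothesis KO : forall x, K x -> oitv0 rho (enorm x).

Let clK : closed K.
Proof. by apply: compact_closed => //; exact: norm_hausdorff. Qed.

(** The weight [g] is only controlled on [(0, rho)]; since [f] vanishes outside a
    compact subset of the punctured ball, this suffices for the product to be
    continuous on the whole space. *)
Lemma radial_cont_compact g f : (forall r, oitv0 rho r -> {for r, continuous g}) ->
  continuous f -> supported K f -> cont_compact (fun x => g (enorm x) * f x).
Proof.
move=> cg cf sf.
have sgf : supported K (fun x => g (enorm x) * f x).
  by move=> x Kx; rewrite sf// mulr0.
split; last exact: supported_norm sgf.
move=> x; have [Kx|Kx] := pselect (K x).
  apply: (@continuousM R _ (fun x => g (enorm x)) f); last exact: cf.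
  apply: (@continuous_comp _ _ _ (@enorm R n) g); first exact: continuous_enorm.
  exact/cg/KO.
rewrite /continuous_at sgf//.
apply: (@cvg_near_cst _ R _ _ (nbhs x) _).
have : nbhs x (~` K) by apply: open_nbhs_nbhs; split => //; exact: closed_openC.
by apply: filterS => y; exact: sgf.
Qed.

Lemma radial_partial g b i x : (forall r, oitv0 rho r -> derivable g r 1) ->
  c1 b -> supported K b ->
  is_derive x (delta_mx 0 i) (fun x => g (enorm x) * b x)
    (if `[< K x >] then g (enorm x) * partial i b x +
       'D_1 g (enorm x) * (x 0 i / enorm x) * b x else 0).
Proof.
move=> dg cb sb; case: asboolP => Kx.
  have r0 := KO Kx.
  have x0 : x != 0 by rewrite -enorm_eq0 gt_eqF//; case: r0.
  have dgr := derivableP (dg _ r0).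
  have d1 := @is_derive_radial R n g ('D_1 g) i x x0 dgr.
  have := is_deriveM d1 (partial_is_derive i x cb).
  by rewrite /GRing.scale /= [b x * _]mulrC.
apply: (@near_eq_is_derive R _ _ (cst 0)).
have : nbhs x (~` K) by apply: open_nbhs_nbhs; split => //; exact: closed_openC.
by apply: filterS => y Ky; rewrite sb// mulr0.
Qed.

(** Outside [K] the product of [b] and the weight vanishes near every point, so it is
    differentiable there although the weight is only controlled on [(0, rho)]. *)
Lemma radial_ibp_le g b k i : (forall r, oitv0 rho r -> derivable g r 1) ->
  c1 b -> supported K b -> cont_compact k -> supported K k ->
  (forall x, K x -> g (enorm x) * partial i b x +
       'D_1 g (enorm x) * (x 0 i / enorm x) * b x <= k x) ->
  nonneg_integral k.
Proof.
move=> dg cb sb cck sk lek; split => //.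
have sgb : supported K (fun x => g (enorm x) * b x).
  by move=> x Kx; rewrite sb// mulr0.
have [M gM] := supported_norm cK sgb.
apply: (ibp (i := i) cck gM) => x.
  by apply: ex_derive; exact: radial_partial.
have -> := derive_val (is_derive := radial_partial i x dg cb sb).
by case: asboolP => Kx; [exact: lek|rewrite sk].
Qed.

(** The function is the divergence of [g(|x|) b(x)]; its integral is in fact zero, as
    the lemma also applies to [- g]. *)
Lemma radial_ibp g dg (b : 'I_n -> 'rV[R]_n -> R) :
  (forall r, oitv0 rho r -> is_derive r 1 g (dg r)) ->
  (forall r, oitv0 rho r -> {for r, continuous dg}) ->
  (forall i, c1 (b i)) -> (forall i, supported K (b i)) ->
  nonneg_integral (fun x => g (enorm x) * (\sum_i partial i (b i) x) +
    dg (enorm x) / enorm x * (\sum_i x 0 i * b i x)).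
Proof.
move=> Dg cdg cb sb.
have cg r : oitv0 rho r -> {for r, continuous g}.
  by move=> /Dg; exact: is_derive1_continuous.
have := @nonneg_integral_sum R n n (fun i x => g (enorm x) * partial i (b i) x +
   dg (enorm x) / enorm x * (x 0 i * b i x)).
move=> H; apply: nonneg_integral_eq (H _) => [x|i].
  by rewrite big_split /= -!mulr_sumr.
apply: (radial_ibp_le (g := g) (i := i) _ (cb i)) => //.
- by move=> r r0; exact: (@ex_derive _ _ _ _ _ _ _ (Dg r r0)).
- apply: cont_compactD.
    apply: radial_cont_compact => //; first by case: (cb i).
    exact: supported_partial.
  apply: (radial_cont_compact (g := fun r => dg r / r)).
  + move=> r r0; apply: (@continuousM _ _ dg (fun r => r^-1)); first exact: cdg.
    by apply: inv_continuous; rewrite gt_eqF//; case: r0.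
  + by apply: contM; [exact: coord_continuous|case: (cb i)].
  + by move=> x Kx; rewrite sb// mulr0.
- by move=> x Kx; rewrite sb// (supported_partial i clK (sb i))// !mulr0 addr0.
- move=> x Kx; have := derive_val (is_derive := Dg _ (KO Kx)) => ->.
  by rewrite le_eqVlt; apply/orP; left; apply/eqP; ring.
Qed.

End radial_ibp.

(** * Vector fields built from the gradient and the Hessian *)

Section fields.
Context {R : realType} (n : nat).
Variables (p : 'I_n -> 'rV[R]_n -> R) (A : 'I_n -> 'I_n -> 'rV[R]_n -> R)
  (T : 'I_n -> 'I_n -> 'I_n -> 'rV[R]_n -> R).
Hypotheses (cp : forall i, c1 (p i)) (cA : forall i j, c1 (A i j)).
Hypotheses (dp : forall i j x, partial i (p j) x = A i j x)
  (dA : forall i j k x, partial i (A j k) x = T i j k x).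
Hypotheses (symA : forall i j x, A i j x = A j i x)
  (symT : forall i j k x, T i j k x = T j i k x).
Implicit Types x : 'rV[R]_n.

Definition lap x := \sum_i A i i x.
Definition hess2 x := \sum_i \sum_j A i j x * A i j x.
Definition xp x := \sum_i x 0 i * p i x.
Definition pp x := \sum_i p i x * p i x.
Definition Ax i x := \sum_j A i j x * x 0 j.
Definition Ap i x := \sum_j A i j x * p j x.
Definition xAx x := \sum_i x 0 i * Ax i x.
Definition pAx x := \sum_i p i x * Ax i x.
Definition AxAx x := \sum_i Ax i x * Ax i x.
(** Gradient of the Laplacian. *)
Definition dlap i x := \sum_j T i j j x.
Definition Tx i j x := \sum_k T i j k x * x 0 k.

Let symT' i j k x : T i j k x = T i k j x.
Proof.
by rewrite -!dA; congr (partial i _ x); apply/funext => y; exact: symA.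
Qed.

Let symTx i j x : Tx i j x = Tx j i x.
Proof. by apply: eq_bigr => k _; rewrite symT. Qed.

(** The divergence of the Hessian is the gradient of the Laplacian. *)
Let sum_divA x (w : 'I_n -> R) :
  \sum_i \sum_j T i i j x * w j = \sum_i dlap i x * w i.
Proof.
rewrite exchange_big; apply: eq_bigr => j _; rewrite /dlap mulr_suml.
by apply: eq_bigr => i _; rewrite symT' symT.
Qed.

Lemma c1_xp : c1 xp /\ forall i x, partial i xp x = Ax i x + p i x.
Proof.
have cj j := c1M (proj1 (@c1_coord R n j)) (cp j).
have [h1 h2] := c1_sum (fun j => proj1 (cj j)).
split=> // i x; rewrite h2.
under eq_bigr do rewrite (proj2 (cj _)) (proj2 (c1_coord _)) dp.
rewrite big_split /= addrC; congr (_ + _).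
  by apply: eq_bigr => j _; rewrite mulrC.
rewrite (bigD1 i)//= eqxx mul1r big1 ?addr0// => j ji.
by rewrite eq_sym (negbTE ji) mul0r.
Qed.

Lemma c1_lap : c1 lap /\ forall i x, partial i lap x = dlap i x.
Proof.
have [h1 h2] := c1_sum (fun j => cA j j).
by split=> // i x; rewrite h2; apply: eq_bigr => j _; rewrite dA.
Qed.

Lemma c1_pp : c1 pp /\ forall i x, partial i pp x = 2 * Ap i x.
Proof.
have cj j := c1M (cp j) (cp j).
have [h1 h2] := c1_sum (fun j => proj1 (cj j)).
split=> // i x; rewrite h2 /Ap mulr_sumr; apply: eq_bigr => j _.
by rewrite (proj2 (cj _)) dp; ring.
Qed.

Lemma c1_Ax j : c1 (Ax j) /\ forall i x, partial i (Ax j) x = Tx i j x + A j i x.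
Proof.
have cj k := c1M (cA j k) (proj1 (@c1_coord R n k)).
have [h1 h2] := c1_sum (fun k => proj1 (cj k)).
split=> // i x; rewrite h2.
under eq_bigr do rewrite (proj2 (cj _)) (proj2 (c1_coord _)) dA.
rewrite big_split /=; congr (_ + _).
rewrite (bigD1 i)//= eqxx mulr1 big1 ?addr0// => k ki.
by rewrite eq_sym (negbTE ki) mulr0.
Qed.

Lemma c1_Ap j : c1 (Ap j) /\ forall i x,
  partial i (Ap j) x = \sum_k T i j k x * p k x + \sum_k A j k x * A i k x.
Proof.
have cj k := c1M (cA j k) (cp k).
have [h1 h2] := c1_sum (fun k => proj1 (cj k)).
split=> // i x; rewrite h2 -big_split; apply: eq_bigr => k _ /=.
by rewrite (proj2 (cj _)) dp dA.
Qed.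

Lemma c1_xAx : c1 xAx /\ forall i x, partial i xAx x =
  Ax i x + \sum_j x 0 j * Tx i j x + Ax i x.
Proof.
have cj j := c1M (proj1 (@c1_coord R n j)) (proj1 (c1_Ax j)).
have [h1 h2] := c1_sum (fun j => proj1 (cj j)).
split=> // i x; rewrite h2.
under eq_bigr do rewrite (proj2 (cj _)) (proj2 (c1_coord _)) (proj2 (c1_Ax _)).
rewrite big_split /= -addrA; congr (_ + _).
  rewrite (bigD1 i)//= eqxx mul1r big1 ?addr0// => j ji.
  by rewrite eq_sym (negbTE ji) mul0r.
rewrite -big_split; apply: eq_bigr => j _ /=.
by rewrite mulrDr [A j i x]symA [_ * A i j x]mulrC.
Qed.

Lemma c1_pAx : c1 pAx /\ forall i x, partial i pAx x =
  \sum_j A i j x * Ax j x + \sum_j p j x * Tx i j x + Ap i x.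
Proof.
have cj j := c1M (cp j) (proj1 (c1_Ax j)).
have [h1 h2] := c1_sum (fun j => proj1 (cj j)).
split=> // i x; rewrite h2.
under eq_bigr do rewrite (proj2 (cj _)) dp (proj2 (c1_Ax _)).
rewrite big_split /= -addrA; congr (_ + _).
rewrite -big_split; apply: eq_bigr => j _ /=.
by rewrite mulrDr [A j i x]symA [_ * A i j x]mulrC.
Qed.

Lemma xApE x : \sum_i x 0 i * Ap i x = pAx x.
Proof.
rewrite /pAx; under eq_bigr do rewrite mulr_sumr.
under [RHS]eq_bigr do rewrite mulr_sumr.
rewrite exchange_big; apply: eq_bigr => i _; apply: eq_bigr => j _.
by rewrite symA; ring.
Qed.

Lemma xAAxE x : \sum_i x 0 i * (\sum_j A i j x * Ax j x) = AxAx x.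
Proof.
rewrite /AxAx; under eq_bigr do rewrite mulr_sumr.
rewrite exchange_big; apply: eq_bigr => j _.
rewrite {2}/Ax mulr_suml; apply: eq_bigr => i _; rewrite symA; ring.
Qed.

(** In the divergences of these fields the third derivatives of [u] cancel, so that
    all of them are polynomials in [x], [p] and [A]. *)
Definition field1 i x := lap x * p i x - Ap i x.
Definition field2 i x := xp x * (lap x * x 0 i - Ax i x).
Definition field3 i x := pAx x * x 0 i - xAx x * p i x.
Definition field4 i x := xp x * p i x.
Definition field5 i x := xp x * xp x * x 0 i.
Definition field6 i x := pp x * x 0 i.

Let c1B (f g : 'rV[R]_n -> R) : c1 f -> c1 g -> c1 (fun x => f x - g x) /\
  forall i x, partial i (fun x => f x - g x) x = partial i f x - partial i g x.
Proof.
move=> cf cg; have [h1 h2] := c1N cg; have [h3 h4] := c1D cf h1.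
by split => // i x; rewrite h4 h2.
Qed.

Lemma c1_field1 i : c1 (field1 i) /\ forall x, partial i (field1 i) x =
  dlap i x * p i x + lap x * A i i x -
  (\sum_k T i i k x * p k x + \sum_k A i k x * A i k x).
Proof.
have [h1 h2] := c1M (proj1 c1_lap) (cp i).
have [h3 h4] := c1B h1 (proj1 (c1_Ap i)).
by split => // x; rewrite h4 h2 dp (proj2 c1_lap) (proj2 (c1_Ap _)).
Qed.

Lemma div_field1 x : \sum_i partial i (field1 i) x = lap x ^+ 2 - hess2 x.
Proof.
under eq_bigr do rewrite (proj2 (c1_field1 _)).
rewrite sumrB !big_split /= sum_divA -mulr_sumr -/(lap x) -/(hess2 x); ring.
Qed.

Lemma x_field1 x : \sum_i x 0 i * field1 i x = lap x * xp x - pAx x.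
Proof.
rewrite -xApE /xp mulr_sumr -sumrB; apply: eq_bigr => i _; rewrite /field1; ring.
Qed.

Lemma c1_field2 i : c1 (field2 i) /\ forall x, partial i (field2 i) x =
  (Ax i x + p i x) * (lap x * x 0 i - Ax i x) +
  xp x * (dlap i x * x 0 i + lap x - (Tx i i x + A i i x)).
Proof.
have [h1 h2] := c1M (proj1 c1_lap) (proj1 (@c1_coord R n i)).
have [h3 h4] := c1B h1 (proj1 (c1_Ax i)).
have [h5 h6] := c1M (proj1 c1_xp) h3.
split => // x; rewrite h6 h4 h2 (proj2 c1_xp) (proj2 c1_lap) (proj2 (c1_Ax _)).
by rewrite (proj2 (c1_coord _)) eqxx mulr1.
Qed.

Lemma div_field2 x : \sum_i partial i (field2 i) x =
  xAx x * lap x - AxAx x - pAx x + n%:R * xp x * lap x.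
Proof.
under eq_bigr do rewrite (proj2 (c1_field2 _)).
rewrite (eq_bigr (fun i => lap x * (x 0 i * Ax i x) - Ax i x * Ax i x
  + lap x * (x 0 i * p i x) - p i x * Ax i x
  + xp x * (dlap i x * x 0 i) + xp x * lap x - xp x * Tx i i x - xp x * A i i x)).
  rewrite !(sumrB, big_split) /= sumr_const card_ord -!mulr_sumr.
  rewrite -sum_divA -/(lap x) -/(xp x) -/(xAx x) -/(AxAx x) -/(pAx x).
  by rewrite -mulr_natl; ring.
by move=> i _; ring.
Qed.

Lemma x_field2 x : \sum_i x 0 i * field2 i x =
  xp x * (enorm x ^+ 2 * lap x - xAx x).
Proof.
rewrite enorm_sqr /xAx mulr_suml -sumrB mulr_sumr.
apply: eq_bigr => i _; rewrite /field2; ring.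
Qed.

Lemma c1_field3 i : c1 (field3 i) /\ forall x, partial i (field3 i) x =
  (\sum_j A i j x * Ax j x + \sum_j p j x * Tx i j x + Ap i x) * x 0 i + pAx x
  - ((Ax i x + \sum_j x 0 j * Tx i j x + Ax i x) * p i x + xAx x * A i i x).
Proof.
have [h1 h2] := c1M (proj1 c1_pAx) (proj1 (@c1_coord R n i)).
have [h3 h4] := c1M (proj1 c1_xAx) (cp i).
have [h5 h6] := c1B h1 h3.
split => // x; rewrite h6 h4 h2 dp (proj2 c1_xAx) (proj2 c1_pAx).
by rewrite (proj2 (c1_coord _)) eqxx mulr1.
Qed.

Lemma div_field3 x : \sum_i partial i (field3 i) x =
  (n%:R - 1) * pAx x + AxAx x - xAx x * lap x.
Proof.
under eq_bigr do rewrite (proj2 (c1_field3 _)).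
rewrite (eq_bigr (fun i => x 0 i * (\sum_j A i j x * Ax j x)
  + x 0 i * (\sum_j p j x * Tx i j x) + x 0 i * Ap i x + pAx x
  - p i x * Ax i x - p i x * (\sum_j x 0 j * Tx i j x) - p i x * Ax i x
  - xAx x * A i i x)); last by move=> i _; ring.
rewrite !(sumrB, big_split) /= sumr_const card_ord -!mulr_sumr.
rewrite xAAxE xApE -/(pAx x) -/(lap x).
suff -> : \sum_i x 0 i * (\sum_j p j x * Tx i j x) =
          \sum_i p i x * (\sum_j x 0 j * Tx i j x).
  by rewrite -mulr_natl; ring.
under eq_bigr do rewrite mulr_sumr.
rewrite exchange_big; apply: eq_bigr => i _; rewrite mulr_sumr.
by apply: eq_bigr => j _; rewrite symTx; ring.
Qed.

Lemma x_field3 x : \sum_i x 0 i * field3 i x =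
  enorm x ^+ 2 * pAx x - xAx x * xp x.
Proof.
rewrite enorm_sqr /xp mulr_suml mulr_sumr -sumrB.
apply: eq_bigr => i _; rewrite /field3; ring.
Qed.

Lemma c1_field4 i : c1 (field4 i) /\ forall x, partial i (field4 i) x =
  (Ax i x + p i x) * p i x + xp x * A i i x.
Proof.
have [h1 h2] := c1M (proj1 c1_xp) (cp i).
by split => // x; rewrite h2 dp (proj2 c1_xp).
Qed.

Lemma div_field4 x : \sum_i partial i (field4 i) x = pAx x + pp x + xp x * lap x.
Proof.
under eq_bigr do rewrite (proj2 (c1_field4 _)).
rewrite big_split /= -mulr_sumr; congr (_ + _).
by rewrite /pAx /pp -big_split; apply: eq_bigr => i _ /=; ring.
Qed.

Lemma x_field4 x : \sum_i x 0 i * field4 i x = xp x ^+ 2.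
Proof.
by rewrite expr2 {2}/xp mulr_sumr; apply: eq_bigr => i _; rewrite /field4; ring.
Qed.

Lemma c1_field5 i : c1 (field5 i) /\ forall x, partial i (field5 i) x =
  2 * xp x * (Ax i x + p i x) * x 0 i + xp x ^+ 2.
Proof.
have [h1 h2] := c1M (proj1 c1_xp) (proj1 c1_xp).
have [h3 h4] := c1M h1 (proj1 (@c1_coord R n i)).
split => // x; rewrite h4 h2 (proj2 c1_xp) (proj2 (c1_coord _)) eqxx /=.
by ring.
Qed.

Lemma div_field5 x : \sum_i partial i (field5 i) x =
  2 * xp x * (xAx x + xp x) + n%:R * xp x ^+ 2.
Proof.
under eq_bigr do rewrite (proj2 (c1_field5 _)).
rewrite big_split /= sumr_const card_ord [n%:R * _]mulr_natl; congr (_ + _).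
have -> : xAx x + xp x = \sum_i x 0 i * (Ax i x + p i x).
  by rewrite -big_split; apply: eq_bigr => i _ /=; ring.
by rewrite mulr_sumr; apply: eq_bigr => i _; ring.
Qed.

Lemma x_field5 x : \sum_i x 0 i * field5 i x = xp x ^+ 2 * enorm x ^+ 2.
Proof.
by rewrite enorm_sqr mulr_sumr; apply: eq_bigr => i _; rewrite /field5; ring.
Qed.

Lemma c1_field6 i : c1 (field6 i) /\ forall x, partial i (field6 i) x =
  2 * Ap i x * x 0 i + pp x.
Proof.
have [h1 h2] := c1M (proj1 c1_pp) (proj1 (@c1_coord R n i)).
split => // x; rewrite h2 (proj2 c1_pp) (proj2 (c1_coord _)) eqxx /=.
by ring.
Qed.

Lemma div_field6 x : \sum_i partial i (field6 i) x = 2 * pAx x + n%:R * pp x.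
Proof.
under eq_bigr do rewrite (proj2 (c1_field6 _)).
rewrite big_split /= sumr_const card_ord [n%:R * _]mulr_natl -xApE mulr_sumr; congr (_ + _).
by apply: eq_bigr => i _; ring.
Qed.

Lemma x_field6 x : \sum_i x 0 i * field6 i x = pp x * enorm x ^+ 2.
Proof.
by rewrite enorm_sqr mulr_sumr; apply: eq_bigr => i _; rewrite /field6; ring.
Qed.

End fields.

(** * Pointwise inequalities *)

Section pointwise.
Context {R : realType} (n : nat).
Variables (A : 'I_n -> 'I_n -> 'rV[R]_n -> R).
Hypotheses (symA : forall i j x, A i j x = A j i x).
Implicit Types x : 'rV[R]_n.

(** Lagrange's identity: the defect is a sum of squares. *)
Lemma cauchy_schwarz_sum x (w : 'I_n -> R) :
  (\sum_i x 0 i * w i) ^+ 2 <= enorm x ^+ 2 * \sum_i w i * w i.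
Proof.
have : 0 <= \sum_i \sum_j (x 0 i * w j - x 0 j * w i) ^+ 2.
  by apply: sumr_ge0 => i _; apply: sumr_ge0 => j _; exact: sqr_ge0.
suff -> : \sum_i \sum_j (x 0 i * w j - x 0 j * w i) ^+ 2 =
    2 * (enorm x ^+ 2 * (\sum_i w i * w i) - (\sum_i x 0 i * w i) ^+ 2).
  by rewrite pmulr_rge0// subr_ge0.
have E i : \sum_j (x 0 i * w j - x 0 j * w i) ^+ 2 =
    x 0 i ^+ 2 * (\sum_j w j * w j) + enorm x ^+ 2 * (w i * w i)
    - 2 * (\sum_j x 0 j * w j) * (x 0 i * w i).
  rewrite enorm_sqr [_ * (x 0 i * w i)]mulrC !mulr_sumr mulr_suml -big_split -sumrB /=.
  by apply: eq_bigr => j _; ring.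
under eq_bigr do rewrite E.
rewrite sumrB big_split /= -mulr_suml -!mulr_sumr -enorm_sqr; ring.
Qed.

(** The quantity is the sum of the squares of the entries of
    [r^2 P A P - sg P], where [P] is the projection orthogonal to [x].  The parameter
    [sg] is taken to be [x.p], which gives [|H|^2], or the mean of the eigenvalues
    of [r^2 P A P] on the tangent space, which gives the trace inequality. *)
Lemma tangential_hessian_ge0 (sg : R) x : x != 0 ->
  0 <= enorm x ^+ 4 * hess2 A x - 2 * enorm x ^+ 2 * AxAx A x + xAx A x ^+ 2
    - 2 * sg * (enorm x ^+ 2 * lap A x - xAx A x) + (n%:R - 1) * sg ^+ 2.
Proof.
move=> x0; set r2 := enorm x ^+ 2.
have r20 : r2 != 0 by rewrite sqrf_eq0 enorm_eq0.
rewrite (_ : enorm x ^+ 4 = r2 ^+ 2); last by rewrite -exprM.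
set a := xAx A x; set Y := AxAx A x; set h := hess2 A x; set D := lap A x.
pose y i := Ax A i x.
pose c := (a + sg) / r2.
have cr : c * r2 = a + sg by rewrite /c divfK.
pose C i j := r2 * A i j x - x 0 i * y j - y i * x 0 j + c * (x 0 i * x 0 j).
have : 0 <= \sum_i \sum_j (C i j - (i == j)%:R * sg) ^+ 2.
  by apply: sumr_ge0 => i _; apply: sumr_ge0 => j _; exact: sqr_ge0.
suff -> : \sum_i \sum_j (C i j - (i == j)%:R * sg) ^+ 2 =
  r2 ^+ 2 * h - 2 * r2 * Y + a ^+ 2 - 2 * sg * (r2 * D - a) + (n%:R - 1) * sg ^+ 2 by [].
have row i : \sum_j (C i j - (i == j)%:R * sg) ^+ 2 =
    \sum_j C i j ^+ 2 - 2 * sg * C i i + sg ^+ 2.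
  rewrite (bigD1 i)//= [in RHS](bigD1 i)//= eqxx mul1r.
  rewrite (eq_bigr (fun j => C i j ^+ 2)); first by ring.
  by move=> j ji; rewrite eq_sym (negbTE ji) mul0r subr0.
have sx : \sum_i x 0 i * x 0 i = r2.
  by rewrite /r2 enorm_sqr; apply: eq_bigr => i _; rewrite expr2.
have sa : \sum_i x 0 i * y i = a by [].
have sY : \sum_i y i * y i = Y by [].
have sC i : \sum_j C i j ^+ 2 =
   r2 ^+ 2 * (\sum_j A i j x * A i j x) + (x 0 i * x 0 i) * Y + (y i * y i) * r2
   + c ^+ 2 * r2 * (x 0 i * x 0 i) - 2 * r2 * (x 0 i * (\sum_j A i j x * y j))
   - 2 * r2 * (y i * y i) + 2 * r2 * c * (x 0 i * y i) + 2 * a * (x 0 i * y i)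
   - 2 * c * a * (x 0 i * x 0 i) - 2 * c * r2 * (x 0 i * y i).
  rewrite (eq_bigr (fun j => r2 ^+ 2 * (A i j x * A i j x) + x 0 i * x 0 i * (y j * y j)
     + y i * y i * (x 0 j * x 0 j) + c ^+ 2 * (x 0 i * x 0 i) * (x 0 j * x 0 j)
     - 2 * r2 * x 0 i * (A i j x * y j) - 2 * r2 * y i * (A i j x * x 0 j)
     + 2 * r2 * c * x 0 i * (A i j x * x 0 j) + 2 * (x 0 i * y i) * (x 0 j * y j)
     - 2 * c * (x 0 i * x 0 i) * (x 0 j * y j) - 2 * c * (x 0 i * y i) * (x 0 j * x 0 j)));
    last by move=> j _; rewrite /C; ring.
  rewrite !(sumrB, big_split) /= -!mulr_sumr sx sa sY -[\sum_j A i j x * x 0 j]/(y i).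
  by ring.
under eq_bigr do rewrite row sC.
rewrite !(sumrB, big_split) /= -!mulr_sumr -!mulr_suml sx sa sY sumr_const card_ord.
have -> : \sum_i x 0 i * (\sum_j A i j x * y j) = Y by exact: (xAAxE symA x).
have -> : \sum_i C i i = r2 * D - 2 * a + c * r2.
  have ya : \sum_i y i * x 0 i = a by apply: eq_bigr => i _; rewrite mulrC.
  by rewrite /C !(sumrB, big_split) /= -!mulr_sumr sx sa ya -/(lap A x) -/D; ring.
rewrite -/(hess2 A x) -/h -mulr_natl.
have sgE : sg = c * r2 - a by rewrite cr addrC addKr.
by rewrite sgE; ring.
Qed.

End pointwise.

(** * The energy inequality, up to the tangential term *)

Lemma is_derive1M (R : realType) (f g : R -> R) (t df dg : R) :
  is_derive t 1 f df -> is_derive t 1 g dg ->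
  is_derive t 1 (fun x => f x * g x) (df * g t + f t * dg).
Proof.
by move=> Df Dg; have := is_deriveM Df Dg; rewrite addrC /GRing.scale /= [g t * _]mulrC.
Qed.

Lemma is_derive1V (R : realType) (t : R) : t != 0 ->
  is_derive t 1 (fun x => x^-1) (- (t^-1 * t^-1)).
Proof.
move=> t0; have := is_deriveV (f := id) t0 (is_derive_id t 1).
by rewrite /GRing.scale /= mulr1 -exprVn expr2.
Qed.

Lemma is_derive1_powV (R : realType) (t : R) k : t != 0 ->
  is_derive t 1 (fun x => x^-1 ^+ k) (- k%:R * t^-1 ^+ k.+1).
Proof.
move=> t0; elim: k => [|k IH].
  by rewrite oppr0 mul0r; exact: is_derive_cst.
under eq_fun do rewrite exprS.
apply: is_derive_eq (is_derive1M (is_derive1V t0) IH) _.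
by rewrite !exprS -natr1; ring.
Qed.

Section radial_pow.
Context {R : realType} (n : nat) (rho : \bar R) (K : set 'rV[R]_n).
Hypothesis cK : compact K.
Hypothesis KO : forall x, K x -> oitv0 rho (enorm x).

Lemma continuous_powV (k : nat) (r : R) : oitv0 rho r ->
  {for r, continuous (fun r : R => r^-1 ^+ k)}.
Proof.
move=> [r0 _]; apply: is_derive1_continuous (is_derive1_powV k _).
by rewrite gt_eqF.
Qed.

(** All the weights of the proof are combinations of [V r^-k] and [V' r^-k]; the
    latter are covered by taking [V'] in the place of [V]. *)
Lemma radial_pow_ibp (V dV : R -> R) (c : R) k (b : 'I_n -> 'rV[R]_n -> R) :
  (forall r, oitv0 rho r -> is_derive r 1 V (dV r)) ->
  (forall r, oitv0 rho r -> {for r, continuous dV}) ->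
  (forall i, c1 (b i)) -> (forall i, supported K (b i)) ->
  nonneg_integral (fun x =>
    c * V (enorm x) * (enorm x)^-1 ^+ k * (\sum_i partial i (b i) x) +
    (c * dV (enorm x) * (enorm x)^-1 ^+ k
     - k%:R * c * V (enorm x) * (enorm x)^-1 ^+ k.+1) * (enorm x)^-1 *
       (\sum_i x 0 i * b i x)).
Proof.
move=> DV cdV cb sb.
apply: (@radial_ibp R n rho K cK KO (fun r => c * V r * r^-1 ^+ k)
  (fun r => c * dV r * r^-1 ^+ k - k%:R * c * V r * r^-1 ^+ k.+1)) => // r r0.
  have rn0 : r != 0 by rewrite gt_eqF//; case: r0.
  apply: is_derive_eq (is_derive1M (is_derive1M (is_derive_cst c r 1) (DV _ r0))
     (is_derive1_powV k rn0)) _.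
  by rewrite /cst; ring.
have cV : {for r, continuous V} by exact: is_derive1_continuous (DV _ r0).
have M (f g : R -> R) : {for r, continuous f} -> {for r, continuous g} ->
  {for r, continuous (fun x => f x * g x)}.
  by move=> cf cg; exact: (continuousM cf cg).
apply: (@continuousB _ _ _ (fun r => c * dV r * r^-1 ^+ k)
  (fun r => k%:R * c * V r * r^-1 ^+ k.+1)).
  apply: (M (fun r => c * dV r)); last exact: continuous_powV.
  by apply: (M (fun=> c)); [exact: cst_continuous|exact: cdV].
apply: (M (fun r => k%:R * c * V r)); last exact: continuous_powV.
by apply: (M (fun=> k%:R * c)); [exact: cst_continuous|].
Qed.

End radial_pow.

Section energy.
Context {R : realType} (n : nat) (rho : \bar R) (K : set 'rV[R]_n).
Hypothesis n0 : (0 < n)%N.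
Hypothesis cK : compact K.
Hypothesis KO : forall x, K x -> oitv0 rho (enorm x).
Variables (p : 'I_n -> 'rV[R]_n -> R) (A : 'I_n -> 'I_n -> 'rV[R]_n -> R)
  (T : 'I_n -> 'I_n -> 'I_n -> 'rV[R]_n -> R).
Hypotheses (cp : forall i, c1 (p i)) (cA : forall i j, c1 (A i j)).
Hypotheses (dp : forall i j x, partial i (p j) x = A i j x)
  (dA : forall i j k x, partial i (A j k) x = T i j k x).
Hypotheses (symA : forall i j x, A i j x = A j i x)
  (symT : forall i j k x, T i j k x = T j i k x).
Hypothesis sp : forall i, supported K (p i).
Hypothesis sA : forall i j, supported K (A i j).

Lemma supported_sum m (F : 'I_m -> 'rV[R]_n -> R) : (forall j, supported K (F j)) ->
  supported K (fun x => \sum_j F j x).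
Proof. by move=> sF x Kx; rewrite big1 // => j _; exact: sF. Qed.

Lemma supportedMl (f g : 'rV[R]_n -> R) : supported K f ->
  supported K (fun x => f x * g x).
Proof. by move=> sf x Kx; rewrite sf// mul0r. Qed.

Lemma supportedMr (f g : 'rV[R]_n -> R) : supported K g ->
  supported K (fun x => f x * g x).
Proof. by move=> sg x Kx; rewrite sg// mulr0. Qed.

Lemma supported_lap : supported K (lap A). Proof. exact: supported_sum. Qed.
Lemma supported_xp : supported K (xp p).
Proof. by apply: supported_sum => j; exact: supportedMr. Qed.
Lemma supported_pp : supported K (pp p).
Proof. by apply: supported_sum => j; exact: supportedMr. Qed.
Lemma supported_Ax i : supported K (Ax A i).
Proof. by apply: supported_sum => j; exact: supportedMl. Qed.
Lemma supported_Ap i : supported K (Ap p A i).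
Proof. by apply: supported_sum => j; exact: supportedMl. Qed.
Lemma supported_xAx : supported K (xAx A).
Proof. by apply: supported_sum => j; apply: supportedMr; exact: supported_Ax. Qed.
Lemma supported_pAx : supported K (pAx p A).
Proof. by apply: supported_sum => j; exact: supportedMl. Qed.
Lemma supported_AxAx : supported K (AxAx A).
Proof. by apply: supported_sum => j; apply: supportedMr; exact: supported_Ax. Qed.
Lemma supported_hess2 : supported K (hess2 A).
Proof. by apply: supported_sum => j; apply: supported_sum => k; exact: supportedMl. Qed.

Lemma supported_field1 i : supported K (field1 p A i).
Proof. by move=> x Kx; rewrite /field1 supported_lap// supported_Ap// mul0r subrr. Qed.
Lemma supported_field2 i : supported K (field2 p A i).
Proof. by move=> x Kx; rewrite /field2 supported_xp// mul0r. Qed.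
Lemma supported_field3 i : supported K (field3 p A i).
Proof. by move=> x Kx; rewrite /field3 supported_pAx// supported_xAx// !mul0r subrr. Qed.
Lemma supported_field4 i : supported K (field4 p i).
Proof. by move=> x Kx; rewrite /field4 supported_xp// mul0r. Qed.
Lemma supported_field5 i : supported K (field5 p i).
Proof. by move=> x Kx; rewrite /field5 supported_xp// !mul0r. Qed.
Lemma supported_field6 i : supported K (field6 p i).
Proof. by move=> x Kx; rewrite /field6 supported_pp// mul0r. Qed.

Lemma cont_p i : continuous (p i). Proof. by case: (cp i). Qed.
Lemma cont_A i j : continuous (A i j). Proof. by case: (cA i j). Qed.
Lemma cont_lap : continuous (lap A).
Proof. by apply: cont_sum => i; exact: cont_A. Qed.
Lemma cont_xp : continuous (xp p).
Proof. by apply: cont_sum => i; apply: contM; [exact: coord_continuous|exact: cont_p]. Qed.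
Lemma cont_pp : continuous (pp p).
Proof. by apply: cont_sum => i; apply: contM; exact: cont_p. Qed.
Lemma cont_Ax i : continuous (Ax A i).
Proof. by apply: cont_sum => j; apply: contM; [exact: cont_A|exact: coord_continuous]. Qed.
Lemma cont_Ap i : continuous (Ap p A i).
Proof. by apply: cont_sum => j; apply: contM; [exact: cont_A|exact: cont_p]. Qed.
Lemma cont_xAx : continuous (xAx A).
Proof. by apply: cont_sum => i; apply: contM; [exact: coord_continuous|exact: cont_Ax]. Qed.
Lemma cont_pAx : continuous (pAx p A).
Proof. by apply: cont_sum => i; apply: contM; [exact: cont_p|exact: cont_Ax]. Qed.
Lemma cont_AxAx : continuous (AxAx A).
Proof. by apply: cont_sum => i; apply: contM; exact: cont_Ax. Qed.
Lemma cont_hess2 : continuous (hess2 A).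
Proof.
by apply: cont_sum => i; apply: cont_sum => j; apply: contM; exact: cont_A.
Qed.

(** The quantity [|H|^2 - M], where [H = r^2 P A P - (x.p) P] is the Hessian of [u]
    along the sphere through [x] and [M = r^2 |p|^2 - (x.p)^2] the square of the
    gradient along this sphere, both rescaled to the unit sphere. *)
Definition tang x : R :=
  enorm x ^+ 4 * hess2 A x - 2 * enorm x ^+ 2 * AxAx A x + xAx A x ^+ 2
  - 2 * xp p x * (enorm x ^+ 2 * lap A x - xAx A x) + (n%:R - 1) * xp p x ^+ 2
  - (enorm x ^+ 2 * pp p x - xp p x ^+ 2).

Lemma supported_tang : supported K tang.
Proof.
move=> x Kx; rewrite /tang supported_hess2// supported_AxAx// supported_xAx//.
by rewrite supported_xp// supported_pp// supported_lap//; ring.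
Qed.

Lemma cont_tang : continuous tang.
Proof.
have E k : continuous (fun x : 'rV[R]_n => enorm x ^+ k).
  elim: k => [|k IH]; first exact: cont_cst.
  under eq_fun do rewrite exprS.
  by apply: contM => //; exact: continuous_enorm.
have S (f : 'rV[R]_n -> R) : continuous f -> continuous (fun x => f x ^+ 2).
  by move=> cf; under eq_fun do rewrite expr2; exact: contM.
apply: contB; [apply: contD; [apply: contB; [apply: contD; [apply: contB|]|]|]|].
- by apply: contM; [exact: E|exact: cont_hess2].
- by apply: contM; [apply: contM; [exact: cont_cst|exact: E]|exact: cont_AxAx].
- by apply: S; exact: cont_xAx.
- apply: contM; [apply: contM; [exact: cont_cst|exact: cont_xp]|].
  by apply: contB; [apply: contM; [exact: E|exact: cont_lap]|exact: cont_xAx].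
- by apply: contM; [exact: cont_cst|apply: S; exact: cont_xp].
- apply: contB; last by apply: S; exact: cont_xp.
  by apply: contM; [exact: E|exact: cont_pp].
Qed.

Section weights.
Variables (V dV ddV : R -> R).
Hypothesis DV : forall r, oitv0 rho r -> is_derive r 1 V (dV r).
Hypothesis DdV : forall r, oitv0 rho r -> is_derive r 1 dV (ddV r).
Hypothesis cddV : forall r, oitv0 rho r -> {for r, continuous ddV}.
Hypothesis V0 : forall r, oitv0 rho r -> 0 <= V r.

Let contV r : oitv0 rho r -> {for r, continuous V}.
Proof. by move=> r0; exact: is_derive1_continuous (DV r0). Qed.

Let contdV r : oitv0 rho r -> {for r, continuous dV}.
Proof. by move=> r0; exact: is_derive1_continuous (DdV r0). Qed.

Let cM (r : R) (f g : R -> R) : {for r, continuous f} -> {for r, continuous g} ->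
  {for r, continuous (fun x => f x * g x)}.
Proof. by move=> cf cg; exact: (continuousM cf cg). Qed.

Lemma cont_compact_Vtang : cont_compact (fun x => V (enorm x) * (enorm x)^-1 ^+ 4 * tang x).
Proof.
apply: (@radial_cont_compact R n rho K cK KO (fun r => V r * r^-1 ^+ 4)).
- move=> r r0; apply: cM; [exact: contV|exact: (@continuous_powV R rho)].
- exact: cont_tang.
- exact: supported_tang.
Qed.

Lemma enorm_neq0 x : K x -> enorm x != 0.
Proof. by move=> /KO[r0 _]; rewrite gt_eqF. Qed.

(** Put [L = tr H].  The combination of fields is the Bochner field of the sphere: up
    to its divergence, [L^2 - |H|^2] equals [(n - 2) M], so [|H|^2 - M] equals
    [((n - 1) |H|^2 - L^2) / (n - 2)], which is nonnegative since [H] acts on a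
    space of dimension [n - 1]. *)
Lemma tang_nonneg3 : (2 < n)%N ->
  nonneg_integral (fun x => V (enorm x) * (enorm x)^-1 ^+ 4 * tang x).
Proof.
move=> n3.
have n2 : 0 < n%:R - 2 :> R by rewrite subr_gt0 ltr_nat.
(* The weights c V, - c V / r^2, c V / r^2, - V / r^2 and V / r^4 of the five
   fields are those of the Bochner field, multiplied by c. *)
pose c : R := (n%:R - 2)^-1.
have ibp c k b := @radial_pow_ibp R n rho K cK KO V dV c k b DV contdV.
have i1 := ibp c 0%N _ (fun i => proj1 (c1_field1 cp cA dp dA symA i)) supported_field1.
have i2 := ibp (- c) 2%N _ (fun i => proj1 (c1_field2 cp cA dp dA symA i)) supported_field2.
have i3 := ibp c 2%N _ (fun i => proj1 (c1_field3 cp cA dp dA symA i)) supported_field3.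
have i4 := ibp (- 1) 2%N _ (fun i => proj1 (c1_field4 cp dp i)) supported_field4.
have i5 := ibp 1 4%N _ (fun i => proj1 (c1_field5 cp dp i)) supported_field5.
have tot := nonneg_integralD (nonneg_integralD (nonneg_integralD (nonneg_integralD i1 i2) i3) i4) i5.
apply: nonneg_integral_le tot cont_compact_Vtang _ => x.
rewrite (div_field1 cp cA dp dA symA symT) (div_field2 cp cA dp dA symA symT).
rewrite (div_field3 cp cA dp dA symA symT) (div_field4 cp dp) (div_field5 cp dp).
rewrite (x_field1 p symA) x_field2 x_field3 x_field4 x_field5.
have [Kx|Kx] := pselect (K x); last first.
  rewrite supported_tang// supported_hess2// supported_AxAx// supported_xAx//.
  rewrite supported_xp// supported_pp// supported_lap// supported_pAx//.
  by rewrite !(expr2, mulr0, mul0r, subr0, addr0).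
have r0 := enorm_neq0 Kx.
have x0 : x != 0 by rewrite -enorm_eq0.
have := V0 (KO Kx).
set r := enorm x; set v := V r => v0.
have Hs := @tangential_hessian_ge0 R n A symA
  ((r ^+ 2 * lap A x - xAx A x) / (n%:R - 1)) x x0.
have n1 : n%:R - 1 != 0 :> R by rewrite subr_eq0 gt_eqF// ltr1n ltnW.
have n20 : n%:R - 2 != 0 :> R by rewrite gt_eqF.
rewrite -subr_ge0.
rewrite (_ : _ - _ = v * r^-1 ^+ 4 * ((n%:R - 1) * c) *
  (enorm x ^+ 4 * hess2 A x - 2 * enorm x ^+ 2 * AxAx A x + xAx A x ^+ 2
    - 2 * ((r ^+ 2 * lap A x - xAx A x) / (n%:R - 1)) * (enorm x ^+ 2 * lap A x - xAx A x)
    + (n%:R - 1) * ((r ^+ 2 * lap A x - xAx A x) / (n%:R - 1)) ^+ 2)).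
  apply: mulr_ge0 => //; apply: mulr_ge0; first apply: mulr_ge0 => //.
    by apply: exprn_ge0; rewrite invr_ge0 enorm_ge0.
  apply: mulr_ge0; last by rewrite invr_ge0 ltW.
  by rewrite subr_ge0 ler1n.
rewrite /tang /c -/r; field.
by rewrite n1 n20.
Qed.

(** With [q = phi' / phi], the square [V |q p - A x / r|^2] bounds the term
    [- V q^2 |p|^2], which may be discontinuous, by terms in which [q] only occurs
    multiplied by [V], hence through the continuous flux.  The bound is made in each
    coordinate direction separately, with weight [x_i^2 / r^2]. *)
Lemma bessel_nonneg (W phi : R -> R) :
  let flux := fun t : R => t ^+ n.-1 * V t * derive1 phi t in
  (forall r, oitv0 rho r -> {for r, continuous W}) ->
  (forall r, oitv0 rho r -> [/\ 0 < phi r, derivable phi r 1,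
      derivable flux r 1 & derive1 flux r + r ^+ n.-1 * W r * phi r = 0]) ->
  nonneg_integral (fun x =>
    V (enorm x) * (enorm x)^-1 ^+ 2 * AxAx A x - W (enorm x) * pp p x).
Proof.
move=> flux cW bessel.
pose psi r : R := flux r / phi r.
have Dpsi r : oitv0 rho r -> is_derive r 1 psi
    (- r ^+ n.-1 * W r - r ^+ n.-1 * V r * (derive1 phi r / phi r) ^+ 2).
  move=> r0; have [ph0 dph dfl e] := bessel r r0.
  have phn0 : phi r != 0 by rewrite gt_eqF.
  have Dfl : is_derive r 1 flux (- (r ^+ n.-1 * W r * phi r)).
    by apply: DeriveDef => //; rewrite -derive1E; apply/eqP; rewrite -addr_eq0 e.
  have Dph : is_derive r 1 phi (derive1 phi r).
    by rewrite derive1E; exact: derivableP.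
  have Dphi : is_derive r 1 (fun t => (phi t)^-1) (- (derive1 phi r / phi r ^+ 2)).
    have := is_deriveV phn0 Dph.
    by rewrite /GRing.scale /= mulNr mulrC.
  apply: is_derive_eq (is_derive1M Dfl Dphi) _.
  by rewrite /flux; field.
have cpsi r : oitv0 rho r -> {for r, continuous psi}.
  by move=> /Dpsi; exact: is_derive1_continuous.
have cpow k r : oitv0 rho r -> {for r, continuous (fun r : R => r^-1 ^+ k)}.
  exact: continuous_powV.
(* The continuous upper bound of the i-th term of the divergence. *)
pose k i x := (-1) * W (enorm x) * (enorm x)^-1 ^+ 2 * (pp p x * (x 0 i * x 0 i))
  + V (enorm x) * (enorm x)^-1 ^+ 4 * (AxAx A x * (x 0 i * x 0 i))
  + (-2) * psi (enorm x) * (enorm x)^-1 ^+ n.+2 * (pAx p A x * (x 0 i * x 0 i))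
  + psi (enorm x) * (enorm x)^-1 ^+ n * (2 * Ap p A i x * x 0 i + pp p x)
  + (- n%:R) * psi (enorm x) * (enorm x)^-1 ^+ n.+2 * (pp p x * (x 0 i * x 0 i)).
have nk i : nonneg_integral (k i).
  have cx : continuous (fun x : 'rV[R]_n => x 0 i * x 0 i).
    by apply: contM; exact: coord_continuous.
  have ccst (c r : R) : {for r, continuous (fun _ : R => c)} by exact: cst_continuous.
  apply: (@radial_ibp_le R n rho K cK KO (fun r => psi r * r^-1 ^+ n) (field6 p i) _ i).
  - move=> r r0; have rn0 : r != 0 by rewrite gt_eqF//; case: r0.
    exact: (@ex_derive _ _ _ _ _ _ _ (is_derive1M (Dpsi _ r0) (is_derive1_powV n rn0))).
  - exact: (c1_field6 cp dp i).1.
  - exact: supported_field6.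
  - apply: cont_compactD; [apply: cont_compactD; [apply: cont_compactD; [apply: cont_compactD|]|]|].
    + apply: (@radial_cont_compact R n rho K cK KO (fun r => (-1) * W r * r^-1 ^+ 2)).
      * move=> r r0; apply: (cM (f := fun r => (-1) * W r)); last exact: cpow.
        by apply: (cM (f := fun=> -1)); [exact: ccst|exact: cW].
      * by apply: contM => //; exact: cont_pp.
      * by apply: supportedMl; exact: supported_pp.
    + apply: (@radial_cont_compact R n rho K cK KO (fun r => V r * r^-1 ^+ 4)).
      * by move=> r r0; apply: cM; [exact: contV|exact: cpow].
      * by apply: contM => //; exact: cont_AxAx.
      * by apply: supportedMl; exact: supported_AxAx.
    + apply: (@radial_cont_compact R n rho K cK KO (fun r => (-2) * psi r * r^-1 ^+ n.+2)).
      * move=> r r0; apply: (cM (f := fun r => (-2) * psi r)); last exact: cpow.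
        by apply: (cM (f := fun=> -2)); [exact: ccst|exact: cpsi].
      * by apply: contM => //; exact: cont_pAx.
      * by apply: supportedMl; exact: supported_pAx.
    + apply: (@radial_cont_compact R n rho K cK KO (fun r => psi r * r^-1 ^+ n)).
      * by move=> r r0; apply: cM; [exact: cpsi|exact: cpow].
      * apply: contD; last exact: cont_pp.
        apply: contM; last exact: coord_continuous.
        by apply: contM; [exact: cont_cst|exact: cont_Ap].
      * by move=> x Kx; rewrite supported_Ap// supported_pp// mulr0 mul0r addr0.
    + apply: (@radial_cont_compact R n rho K cK KO (fun r => (- n%:R) * psi r * r^-1 ^+ n.+2)).
      * move=> r r0; apply: (cM (f := fun r => (- n%:R) * psi r)); last exact: cpow.
        by apply: (cM (f := fun=> - n%:R)); [exact: ccst|exact: cpsi].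
      * by apply: contM => //; exact: cont_pp.
      * by apply: supportedMl; exact: supported_pp.
  - move=> x Kx; rewrite /k supported_pp// supported_AxAx// supported_pAx//.
    by rewrite supported_Ap// !(mul0r, mulr0, addr0).
  - move=> x Kx; have r0 := KO Kx; have rn0 := enorm_neq0 Kx.
    have [ph0 _ _ _] := bessel _ r0.
    have Dg := is_derive1M (Dpsi _ r0) (is_derive1_powV n rn0).
    rewrite (derive_val (is_derive := Dg)) (c1_field6 cp dp i).2 /k /field6 -subr_ge0.
    have sq : 0 <= \sum_j (derive1 phi (enorm x) / phi (enorm x) * p j x
                          - (enorm x)^-1 * Ax A j x) ^+ 2.
      by apply: sumr_ge0 => j _; exact: sqr_ge0.
    have sqE : \sum_j (derive1 phi (enorm x) / phi (enorm x) * p j x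
                          - (enorm x)^-1 * Ax A j x) ^+ 2 =
      (derive1 phi (enorm x) / phi (enorm x)) ^+ 2 * pp p x
      - 2 * (derive1 phi (enorm x) / phi (enorm x)) * (enorm x)^-1 * pAx p A x
      + (enorm x)^-1 ^+ 2 * AxAx A x.
      rewrite /pp /pAx /AxAx !mulr_sumr -sumrB -big_split /=.
      by apply: eq_bigr => j _; ring.
    rewrite sqE in sq.
    have := mulr_ge0 (mulr_ge0 (mulr_ge0 (V0 r0) (sqr_ge0 (x 0 i))) (sqr_ge0 (enorm x)^-1)) sq.
    move=> /le_trans; apply; rewrite le_eqVlt; apply/orP; left; apply/eqP.
    rewrite /psi /flux.
    move: (enorm x) (derive1 phi (enorm x)) (phi (enorm x)) rn0 ph0 => r dph ph rn0 ph0.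
    have phn0 : ph != 0 by rewrite gt_eqF.
    have nE : r^-1 ^+ n = r^-1 * r^-1 ^+ n.-1 by rewrite -exprS prednK.
    have vE : r ^+ n.-1 = (r^-1 ^+ n.-1)^-1 by rewrite exprVn invrK.
    have : r^-1 ^+ n.-1 != 0 by rewrite expf_neq0 ?invr_eq0.
    rewrite !exprS nE vE; move: (r^-1 ^+ n.-1) => w w0; field.
    by rewrite w0 phn0 rn0.
have := @nonneg_integral_sum R n n k nk.
have ck : cont_compact (fun x => V (enorm x) * (enorm x)^-1 ^+ 2 * AxAx A x - W (enorm x) * pp p x).
  apply: cont_compactD; last apply: cont_compactN.
    apply: (@radial_cont_compact R n rho K cK KO (fun r => V r * r^-1 ^+ 2)).
    - by move=> r r0; apply: cM; [exact: contV|exact: cpow].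
    - exact: cont_AxAx.
    - exact: supported_AxAx.
  by apply: (@radial_cont_compact R n rho K cK KO) => //; [exact: cont_pp|exact: supported_pp].
move=> tot; apply: nonneg_integral_le tot ck _ => x.
have [Kx|Kx] := pselect (K x); last first.
  rewrite big1; last first.
    move=> i _; rewrite /k supported_pp// supported_AxAx// supported_pAx//.
    by rewrite supported_Ap// !(mul0r, mulr0, addr0).
  by rewrite supported_AxAx// supported_pp// !mulr0 subr0.
have rn0 := enorm_neq0 Kx.
rewrite /k !big_split /= -!mulr_sumr.
have sx : \sum_i x 0 i * x 0 i = enorm x ^+ 2.
  by rewrite enorm_sqr; apply: eq_bigr => i _; rewrite expr2.
have sA2 : \sum_i (2 * Ap p A i x * x 0 i) = 2 * pAx p A x.
  by rewrite -(xApE p symA) mulr_sumr; apply: eq_bigr => i _; ring.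
rewrite big_split /= sA2 sumr_const card_ord sx -[pp p x *+ n]mulr_natl.
rewrite le_eqVlt; apply/orP; left; apply/eqP.
move: (enorm x) rn0 => r rn0.
rewrite !exprS; field.
exact: rn0.
Qed.

(** The integrand minus all the functions of nonnegative integral used here is
    [C M / r^2 + V B / r^4], where [- C] is the left-hand side of the differential
    inequality for [V]. *)
Lemma energy_nonneg (W phi : R -> R) :
  let flux := fun t : R => t ^+ n.-1 * V t * derive1 phi t in
  (forall r, oitv0 rho r -> {for r, continuous W}) ->
  (forall r, oitv0 rho r -> [/\ 0 < phi r, derivable phi r 1,
      derivable flux r 1 & derive1 flux r + r ^+ n.-1 * W r * phi r = 0]) ->
  (forall r, oitv0 rho r ->
    ddV r - 3 * (dV r / r) - (n%:R - 5) * (V r / r ^+ 2) <= 0) ->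
  nonneg_integral (fun x => V (enorm x) * (enorm x)^-1 ^+ 4 * tang x) ->
  let I x := V (enorm x) * lap A x ^+ 2 - W (enorm x) * pp p x
    - (n%:R - 1) * ((V (enorm x) / enorm x ^+ 2 - dV (enorm x) / enorm x) * pp p x) in
  cont_compact I -> nonneg_integral I.
Proof.
move=> flux cW bessel hV ntang I cI.
have nB := bessel_nonneg cW bessel.
have ibp c k b := @radial_pow_ibp R n rho K cK KO V dV c k b DV contdV.
have ibp' c k b := @radial_pow_ibp R n rho K cK KO dV ddV c k b DdV cddV.
(* The first field is that of Bochner's identity with weight V; the others have
   weight 2 V / r^2 - V' / r, positive on field4 and negative on field6. *)
have i1 := ibp 1 0%N _ (fun i => proj1 (c1_field1 cp cA dp dA symA i)) supported_field1.
have i2 := ibp 2 2%N _ (fun i => proj1 (c1_field4 cp dp i)) supported_field4.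
have i3 := ibp' (- 1) 1%N _ (fun i => proj1 (c1_field4 cp dp i)) supported_field4.
have i4 := ibp (- 2) 2%N _ (fun i => proj1 (c1_field6 cp dp i)) supported_field6.
have i5 := ibp' 1 1%N _ (fun i => proj1 (c1_field6 cp dp i)) supported_field6.
have tot := nonneg_integralD (nonneg_integralD (nonneg_integralD (nonneg_integralD
  (nonneg_integralD (nonneg_integralD i1 i2) i3) i4) i5) nB) ntang.
apply: nonneg_integral_le tot cI _ => x; rewrite /I.
rewrite (div_field1 cp cA dp dA symA symT) (div_field4 cp dp) (div_field6 cp dp symA).
rewrite (x_field1 p symA) x_field4 x_field6.
have [Kx|Kx] := pselect (K x); last first.
  rewrite supported_tang// supported_hess2// supported_AxAx//.
  rewrite supported_xp// supported_pp// supported_lap// supported_pAx//.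
  by rewrite !(expr2, mulr0, mul0r, subr0, addr0).
have r0 := enorm_neq0 Kx.
have x0 : x != 0 by rewrite -enorm_eq0.
have hVx : 0 <= - (ddV (enorm x) - 3 * (dV (enorm x) / enorm x)
   - (n%:R - 5) * (V (enorm x) / enorm x ^+ 2)) by rewrite oppr_ge0; exact/hV/KO.
have M0 : 0 <= enorm x ^+ 2 * pp p x - xp p x ^+ 2.
  by rewrite subr_ge0; exact: cauchy_schwarz_sum.
have B0 : 0 <= enorm x ^+ 2 * (AxAx A x + 2 * pAx p A x + pp p x)
    - (xAx A x + xp p x) ^+ 2.
  have := cauchy_schwarz_sum x (fun i => Ax A i x + p i x).
  have -> : \sum_i x 0 i * (Ax A i x + p i x) = xAx A x + xp p x.
    by rewrite -big_split; apply: eq_bigr => i _ /=; ring.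
  have -> : \sum_i (Ax A i x + p i x) * (Ax A i x + p i x) =
      AxAx A x + 2 * pAx p A x + pp p x.
    by rewrite mulr_sumr -!big_split; apply: eq_bigr => i _ /=; ring.
  by rewrite subr_ge0.
have i0 k : 0 <= (enorm x)^-1 ^+ k by rewrite exprn_ge0 ?invr_ge0 ?enorm_ge0.
have S0 := addr_ge0 (mulr_ge0 (i0 2%N) (mulr_ge0 hVx M0))
  (mulr_ge0 (mulr_ge0 (V0 (KO Kx)) (i0 4%N)) B0).
rewrite -subr_ge0; apply: (le_trans S0).
rewrite le_eqVlt; apply/orP; left; apply/eqP; rewrite /tang.
move: (enorm x) r0 => r r0; field.
exact: r0.
Qed.

(** On the line, Cauchy-Schwarz is an equality and [M] vanishes. *)
Lemma tang_nonneg1 : n = 1%N ->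
  nonneg_integral (fun x => V (enorm x) * (enorm x)^-1 ^+ 4 * tang x).
Proof.
move=> n1; apply: nonneg_integral_ge0; first exact: cont_compact_Vtang.
move=> x; have [Kx|Kx] := pselect (K x); last by rewrite supported_tang ?mulr0.
have x0 : x != 0 by rewrite -enorm_eq0 enorm_neq0.
apply: mulr_ge0.
  by rewrite mulr_ge0 ?V0 ?exprn_ge0 ?invr_ge0 ?enorm_ge0//; exact: KO.
have cs1 m (z : 'rV[R]_m) (q : 'I_m -> R) : m = 1%N ->
    enorm z ^+ 2 * (\sum_i q i * q i) = (\sum_i z 0 i * q i) ^+ 2.
  by move=> m1; subst m; rewrite enorm_sqr !big_ord1; ring.
have M0 : enorm x ^+ 2 * pp p x = xp p x ^+ 2 by exact: cs1.
rewrite /tang M0 subrr subr0.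
exact: tangential_hessian_ge0.
Qed.

End weights.
End energy.

(** * Wirtinger's inequality on the circle *)

Section wirtinger.
Context {R : realType}.
Implicit Types (t s : R).

Lemma is_derive1_affine (l d s t : R) : is_derive t 1 (fun x => l * (x - s) + d) l.
Proof.
have := is_deriveD (is_derive1M (is_derive_cst l t 1)
  (is_deriveB (is_derive_id t 1) (is_derive_cst s t 1))) (is_derive_cst d t 1).
by move=> /is_derive_eq; apply; rewrite /cst; ring.
Qed.

(** The function [y = l cot(l (t - s) + d)] solves the Riccati equation
    [y' = - l^2 - y^2]. *)
Lemma is_derive1_cot (l d s t : R) : sin (l * (t - s) + d) != 0 ->
  is_derive t 1 (fun x => l * (cos (l * (x - s) + d) / sin (l * (x - s) + d)))
    (- l ^+ 2 - (l * (cos (l * (t - s) + d) / sin (l * (t - s) + d))) ^+ 2).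
Proof.
move=> sn0; set th := l * (t - s) + d in sn0 *.
have dth := is_derive1_affine l d s t.
pose q x := l * (x - s) + d.
have dc := @is_derive1_comp _ cos q t _ _ (is_derive_cos th) dth.
have ds := @is_derive1_comp _ sin q t _ _ (is_derive_sin th) dth.
have dsV := @is_derive1_comp _ (fun x => x^-1) (sin \o q) t _ _ (is_derive1V sn0) ds.
have := is_derive1M (is_derive_cst l t 1) (is_derive1M dc dsV).
move=> /is_derive_eq; apply; rewrite /cst /= -/th.
by move: (cos th) (sin th) sn0 => c s0 s00; field.
Qed.

Variables (g g1 g2 : R -> R).
Hypothesis dg : forall t, is_derive t 1 g (g1 t).
Hypothesis dg1 : forall t, is_derive t 1 g1 (g2 t).

(** Jacobi's method: with [v = g1 - c] and [y] the solution of the Riccati equation,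
    [v'^2 - l^2 v^2 - (v^2 y)' = (v' - v y)^2], and [v^2 y] vanishes at both ends of
    the half period.  Since [l < 1], [y] has no pole on this closed interval. *)
Lemma wirtinger_half (K M : R -> R) (c s l : R) : 0 < l -> l < 1 ->
  (forall t, s <= t <= s + pi -> is_derive t 1 K (g2 t ^+ 2 - g1 t ^+ 2)) ->
  (forall t, s <= t <= s + pi -> is_derive t 1 M (g1 t ^+ 2)) ->
  g1 s = c -> g1 (s + pi) = c ->
  0 <= (K (s + pi) - K s) + (1 - l ^+ 2) * (M (s + pi) - M s)
    + 2 * l ^+ 2 * c * (g (s + pi) - g s) - l ^+ 2 * c ^+ 2 * pi.
Proof.
move=> l0 l1 dK dM gs gp.
have pi0 := pi_gt0 R.
(* With this phase the argument of the cotangent stays between d and pi - d. *)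
pose d : R := (1 - l) * pi / 2.
have d0 : 0 < d by rewrite /d !mulr_gt0 ?subr_gt0// invr_gt0.
have sn t : s <= t <= s + pi -> sin (l * (t - s) + d) != 0.
  move=> /andP[ts tp]; rewrite gt_eqF//; apply: sin_gt0_pi.
  have h1 : 0 <= l * (t - s) by rewrite mulr_ge0 ?subr_ge0// ltW.
  have h2 : l * (t - s) <= l * pi by rewrite ler_pM2l// lerBlDl.
  have h3 : l * pi + d < pi.
    rewrite -subr_gt0 (_ : _ - _ = d); first exact: d0.
    by rewrite /d; field.
  by rewrite (ltr_wpDl h1 d0) (le_lt_trans _ h3)// lerD2r.
pose y t := l * (cos (l * (t - s) + d) / sin (l * (t - s) + d)).
pose S t := K t + ((1 - l ^+ 2) * M t + (2 * l ^+ 2 * c * g t +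
   ((- (l ^+ 2 * c ^+ 2)) * t + (-1) * ((g1 t - c) * (g1 t - c) * y t)))).
have := @nondecreasing_is_derive R S (fun t => (g2 t - (g1 t - c) * y t) ^+ 2) s (s + pi).
rewrite lerDl ltW// => /(_ isT) H.
have {}H : S s <= S (s + pi).
  apply: H => [t tI|t tI]; last exact: sqr_ge0.
  have dy := is_derive1_cot (sn t tI).
  have dv : is_derive t 1 (fun t => g1 t - c) (g2 t).
    by apply: is_derive_eq (is_deriveB (dg1 t) (is_derive_cst c t 1)) _; rewrite subr0.
  have C (a : R) := is_derive_cst a t (1 : R).
  have := is_deriveD (dK t tI) (is_deriveD (is_derive1M (C (1 - l ^+ 2)) (dM t tI))
    (is_deriveD (is_derive1M (C (2 * l ^+ 2 * c)) (dg t))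
    (is_deriveD (is_derive1M (C (- (l ^+ 2 * c ^+ 2))) (is_derive_id t 1))
    (is_derive1M (C (-1)) (is_derive1M (is_derive1M dv dv) dy))))).
  move=> /is_derive_eq; apply; rewrite /cst -/(y t).
  by ring.
move: H; rewrite -subr_ge0 /S gs gp !subrr !mul0r => /le_trans; apply.
by rewrite le_eqVlt; apply/orP; left; apply/eqP; ring.
Qed.

Hypotheses (cg2 : continuous g2).
Hypotheses (pg : periodic g (pi *+ 2)) (pg1 : periodic g1 (pi *+ 2))
  (pg2 : periodic g2 (pi *+ 2)).

(** By the intermediate value theorem [g1] takes the same value [c] at two points half
    a period apart, so the half-period inequality applies twice to [g1 - c]; the
    cross terms cancel because [g] is periodic, and [l] tends to 1. *)
Lemma wirtinger : (0 <= \int[lebesgue_measure]_(t in `[0%R, (pi *+ 2)%R])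
  (g2 t ^+ 2 - g1 t ^+ 2)%:E)%E.
Proof.
have pi0 := pi_gt0 R.
have cg1 : continuous g1 by move=> t; exact: is_derive1_continuous (dg1 t).
have ck : continuous (fun t => g2 t ^+ 2 - g1 t ^+ 2).
  under eq_fun do rewrite !expr2.
  by apply: contB; exact: contM.
have cm : continuous (fun t => g1 t ^+ 2).
  by under eq_fun do rewrite !expr2; exact: contM.
have [K dK] := continuous_antiderivative (-1) ck.
have [M dM] := continuous_antiderivative (-1) cm.
have m1 t : 0 <= t -> -1 < t by move=> t0; rewrite (lt_le_trans _ t0)// oppr_lt0.
have pi2 : 0 < pi *+ 2 :> R by rewrite pmulrn_lgt0.
have dK0 t : 0 <= t <= pi *+ 2 -> is_derive t 1 K (g2 t ^+ 2 - g1 t ^+ 2).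
  by move=> /andP[t0 _]; exact/dK/m1.
rewrite (integral_antiderivative pi2 ck dK0).
rewrite lee_fin.
pose d t := g1 (t + pi) - g1 t.
have cd : continuous d.
  apply: contB => //.
  by move=> t; apply: (@continuous_comp _ _ _ (fun t => t + pi) g1);
    [apply: contD; [move=> ?; exact: cvg_id|exact: cont_cst]|exact: cg1].
have dpi : d pi = - d 0.
  by rewrite /d add0r -mulr2n -[pi *+ 2]add0r pg1 opprB.
have [||c cI c0] := @IVT R d 0 pi 0 (ltW pi0).
- exact: continuous_subspaceT.
- rewrite dpi ge_min le_max; case: (leP 0 (d 0)) => h.
    by rewrite oppr_le0 h !orbT.
  by rewrite (ltW h) oppr_ge0 (ltW h) orbT.
have c00 : 0 <= c by move: cI; rewrite in_itv /= => /andP[].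
have gc : g1 (c + pi) = g1 c by apply/eqP; rewrite -subr_eq0 -/(d c) c0.
have gc2 : g1 (c + pi + pi) = g1 c by rewrite -addrA -mulr2n pg1.
have cpi : 0 <= c + pi by rewrite addr_ge0// ltW.
have shiftK : K (c + pi *+ 2) - K c = K (pi *+ 2) - K 0.
  pose P t := K (t + pi *+ 2) - K t.
  have dP t : 0 <= t <= c -> is_derive t 1 P 0.
    move=> /andP[t0 _].
    have dsh : is_derive t 1 (fun t => t + pi *+ 2) 1.
      by have := is_derive1_affine 1 (pi *+ 2) 0 t; under eq_fun do rewrite mul1r subr0.
    have dKs : is_derive (t + pi *+ 2) 1 K (g2 (t + pi *+ 2) ^+ 2 - g1 (t + pi *+ 2) ^+ 2).
      by apply: dK; apply: m1; rewrite addr_ge0// ltW.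
    have := is_deriveB (@is_derive1_comp _ K (fun t => t + pi *+ 2) t _ _ dKs dsh) (dK _ (m1 _ t0)).
    by move=> /is_derive_eq; apply; rewrite pg1 pg2; ring.
  have e1 := nondecreasing_is_derive c00 dP (fun t _ => lexx 0).
  have dN t : 0 <= t <= c -> is_derive t 1 (fun t => - P t) 0.
    by move=> /dP H; have := is_deriveN H; rewrite oppr0.
  have e2 := nondecreasing_is_derive c00 dN (fun t _ => lexx 0).
  have : P 0 = P c by apply/eqP; rewrite eq_le e1 -lerN2.
  by rewrite /P add0r => ->.
rewrite -shiftK.
set Mt := M (c + pi *+ 2) - M c.
have half (l : R) : 0 < l -> l < 1 -> 0 <= (K (c + pi *+ 2) - K c) + (1 - l ^+ 2) * Mt.
  move=> l0 l1.
  have dK1 t : c <= t <= c + pi -> is_derive t 1 K (g2 t ^+ 2 - g1 t ^+ 2).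
    by move=> /andP[ct _]; apply/dK/m1; exact: le_trans ct.
  have dM1 t : c <= t <= c + pi -> is_derive t 1 M (g1 t ^+ 2).
    by move=> /andP[ct _]; apply/dM/m1; exact: le_trans ct.
  have dK2 t : c + pi <= t <= c + pi + pi -> is_derive t 1 K (g2 t ^+ 2 - g1 t ^+ 2).
    by move=> /andP[ct _]; apply/dK/m1; exact: le_trans ct.
  have dM2 t : c + pi <= t <= c + pi + pi -> is_derive t 1 M (g1 t ^+ 2).
    by move=> /andP[ct _]; apply/dM/m1; exact: le_trans ct.
  have h1 := wirtinger_half l0 l1 dK1 dM1 erefl gc.
  have h2 := wirtinger_half l0 l1 dK2 dM2 gc gc2.
  have h3 : 0 <= l ^+ 2 * g1 c ^+ 2 * pi *+ 2.
    apply: mulrn_wge0; exact: mulr_ge0 (mulr_ge0 (sqr_ge0 _) (sqr_ge0 _)) (ltW pi0).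
  have := addr_ge0 (addr_ge0 h1 h2) h3.
  move=> /le_trans; apply; rewrite le_eqVlt; apply/orP; left; apply/eqP.
  have -> : c + pi + pi = c + pi *+ 2 by rewrite -addrA -mulr2n.
  by rewrite /Mt pg; ring.
apply/ler_addgt0Pr => /= e e0; rewrite -[leRHS]/(_ + e).
(* l is chosen with 1 - l^2 = q so small that the error is at most e. *)
pose q : R := Num.min (1 / 2) (e / (`|Mt| + 1)).
have Mt1 : 0 < `|Mt| + 1 by rewrite ltr_wpDl.
have q0 : 0 < q by rewrite lt_min !divr_gt0.
have q1 : q < 1 by rewrite gt_min ltr_pdivrMr// mul1r ltr1n.
have s0 : 0 < Num.sqrt (1 - q) by rewrite sqrtr_gt0 subr_gt0.
have s1 : Num.sqrt (1 - q) < 1.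
  by rewrite -[ltRHS]sqrtr1 ltr_sqrt// ltrBlDr ltrDl.
have qE : 1 - Num.sqrt (1 - q) ^+ 2 = q.
  by rewrite sqr_sqrtr ?subr_ge0 ?ltW//; ring.
have := half _ s0 s1; rewrite qE.
move=> /le_trans; apply; rewrite lerD2l.
apply: (@le_trans _ _ (q * (`|Mt| + 1))).
  by rewrite ler_pM2l//; apply: le_trans (ler_norm _) _; rewrite lerDl.
by rewrite -ler_pdivlMr// ge_min lexx orbT.
Qed.

End wirtinger.

(** * Curves in the plane *)

Section plane.
Context {R : realType}.
Implicit Types (a b c s t : R) (x : 'rV[R]_2).

Definition pt2 a b : 'rV[R]_2 := cons_rV (a, cons_rV (b, 0)).

Notation i1 := (lift ord0 ord0 : 'I_2).

Lemma pt20 a b : pt2 a b 0 ord0 = a. Proof. by rewrite mxE unlift_none. Qed.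
Lemma pt21 a b : pt2 a b 0 i1 = b. Proof. by rewrite mxE liftK mxE unlift_none. Qed.
Definition pt2E := (pt20, pt21).

Lemma ord2P (i : 'I_2) : i = ord0 \/ i = i1.
Proof.
by case: (unliftP ord0 i) => [j ->|->]; [right; rewrite [j]ord1|left].
Qed.

Lemma pt2_eta x : pt2 (x 0 ord0) (x 0 i1) = x.
Proof. by apply/rowP => i; case: (ord2P i) => ->; rewrite pt2E. Qed.

Lemma cvg_pt2 (T : Type) (F : set_system T) {FF : Filter F} (f g : T -> R) a b :
  f t @[t --> F] --> a -> g t @[t --> F] --> b ->
  pt2 (f t) (g t) @[t --> F] --> pt2 a b.
Proof.
move=> fa gb; apply: coord_cvg_rV => i.
by case: (ord2P i) => ->; rewrite pt2E; under eq_fun do rewrite pt2E.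
Qed.

Lemma cont_pt2 (T : topologicalType) (f g : T -> R) :
  continuous f -> continuous g -> continuous (fun z => pt2 (f z) (g z)).
Proof. by move=> cf cg z; apply: (@cvg_pt2 _ (nbhs z)); [exact: cf|exact: cg]. Qed.

Lemma is_derive_of_cvg (f : R -> R) (t l : R) :
  h^-1 * (f (h + t) - f t) @[h --> 0^'] --> l -> is_derive t 1 f l.
Proof.
move=> H.
have E : (fun h : R => h^-1 *: ((f \o shift t) (h *: (1 : R)) - f t)) =
  (fun h => h^-1 * (f (h + t) - f t)).
  by apply/funext => h; rewrite /GRing.scale /= mulr1.
apply: DeriveDef.
  by apply/cvg_ex; exists l; rewrite E.
by rewrite /derive E; exact: cvg_lim.
Qed.

Lemma cvg_of_is_derive (f : R -> R) (t l : R) :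
  is_derive t 1 f l -> h^-1 * (f (h + t) - f t) @[h --> 0^'] --> l.
Proof.
move=> [/cvg_ex[m fm] <-].
have E : (fun h : R => h^-1 *: ((f \o shift t) (h *: (1 : R)) - f t)) =
  (fun h => h^-1 * (f (h + t) - f t)).
  by apply/funext => h; rewrite /GRing.scale /= mulr1.
rewrite /derive E.
by move: fm; rewrite E => fm; rewrite (cvg_lim _ fm).
Qed.

Lemma MVT_signed (f df : R -> R) a b :
  (forall t, is_derive t 1 f (df t)) ->
  exists2 c, `|c - a| <= `|b - a| & f b - f a = (b - a) * df c.
Proof.
move=> dF.
have cf u v : {within `[u, v], continuous f}.
  by apply: continuous_subspaceT => t; exact: is_derive1_continuous (dF t).
have [ab|/ltW ba] := leP a b.
  have [|c /[!in_itv]/= /andP[ac cb] e] := @MVT_segment R f df a b ab.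
    exact: cf.
  exists c; last by rewrite e mulrC.
  by rewrite !ger0_norm ?subr_ge0// lerD2r.
have [|c /[!in_itv]/= /andP[bc ca] e] := @MVT_segment R f df b a ba.
  exact: cf.
exists c; last by apply: oppr_inj; rewrite opprB e; ring.
by rewrite distrC [leRHS]distrC !ger0_norm ?subr_ge0// lerD2l lerN2.
Qed.

Lemma is_derive_pt20 f a b : c1 f ->
  is_derive a 1 (fun a => f (pt2 a b)) (partial ord0 f (pt2 a b)).
Proof.
move=> cf.
have [|H1 H2] := @derive_line R R^o _ _ (fun a => f (pt2 a b)) f a 1
  (pt2 a b) (delta_mx 0 ord0) _ (@c1_derivable _ _ f _ _ cf).
  by move=> h; congr f; exact: cons_rV_line0.
exact: DeriveDef.
Qed.

Lemma is_derive_pt21 f a b : c1 f ->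
  is_derive b 1 (fun b => f (pt2 a b)) (partial i1 f (pt2 a b)).
Proof.
move=> cf.
have [|H1 H2] := @derive_line R R^o _ _ (fun b => f (pt2 a b)) f b 1
  (pt2 a b) (delta_mx 0 i1) _ (@c1_derivable _ _ f _ _ cf).
  by move=> h; congr f; rewrite /pt2 cons_rV_line0 cons_rV_line.
exact: DeriveDef.
Qed.

(** The increment of [f] is split into one in each coordinate, and the mean value
    theorem turns each of them into a partial derivative at a nearby point. *)
Lemma is_derive_curve f (a b : R -> R) a' b' t : c1 f ->
  is_derive t 1 a a' -> is_derive t 1 b b' ->
  is_derive t 1 (fun t => f (pt2 (a t) (b t)))
    (a' * partial ord0 f (pt2 (a t) (b t)) + b' * partial i1 f (pt2 (a t) (b t))).
Proof.
move=> cf da db; apply: is_derive_of_cvg.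
have mvt0 h : exists c, `|c - a t| <= `|a (h + t) - a t| /\
  f (pt2 (a (h + t)) (b (h + t))) - f (pt2 (a t) (b (h + t))) =
  (a (h + t) - a t) * partial ord0 f (pt2 c (b (h + t))).
  have [c ? ?] := MVT_signed (a t) (a (h + t)) (fun c => is_derive_pt20 c (b (h + t)) cf).
  by exists c.
have mvt1 h : exists c, `|c - b t| <= `|b (h + t) - b t| /\
  f (pt2 (a t) (b (h + t))) - f (pt2 (a t) (b t)) =
  (b (h + t) - b t) * partial i1 f (pt2 (a t) c).
  have [c ? ?] := MVT_signed (b t) (b (h + t)) (fun c => is_derive_pt21 (a t) c cf).
  by exists c.
have [xi /all_and2[xi1 xi2]] := choice mvt0.
have [eta /all_and2[eta1 eta2]] := choice mvt1.
under eq_fun => h.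
  rewrite -(subrKA (f (pt2 (a t) (b (h + t))))) xi2 eta2 mulrDr !mulrA.
  over.
have shift_cvg (u : R -> R) (du : R) : is_derive t 1 u du -> u (h + t) @[h --> 0^'] --> u t.
  move=> /is_derive1_continuous cu; apply: cvg_within_filter.
  have ca : continuous (fun h : R => h + t).
    by apply: contD; [move=> ?; exact: cvg_id|exact: cont_cst].
  have cu0 : {for 0 + t, continuous u} by rewrite add0r.
  have : u (h + t) @[h --> (0 : R)] --> u (0 + t).
    exact: (@continuous_comp _ _ _ (fun h : R => h + t) u 0 (ca 0) cu0).
  by rewrite add0r.
have squeeze (u : R -> R) (du : R) (v : R -> R) : is_derive t 1 u du ->
   (forall h, `|v h - u t| <= `|u (h + t) - u t|) -> v h @[h --> 0^'] --> u t.
  move=> /shift_cvg cu vu; apply/cvgrPdist_le => e e0.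
  move/cvgrPdist_le : cu => /(_ _ e0); apply: filterS => h; rewrite distrC => uh.
  by rewrite distrC; exact: le_trans (vu h) uh.
have cp i : continuous (partial i f) by case: cf.
apply: cvgD; apply: cvgM; try exact: cvg_of_is_derive.
- apply: (@cvg_comp _ _ _ (fun h => pt2 (xi h) (b (h + t))) (partial ord0 f) _ (nbhs (pt2 (a t) (b t))));
    last exact: cp.
  by apply: cvg_pt2; [exact: squeeze da xi1|exact: shift_cvg db].
- apply: (@cvg_comp _ _ _ (fun h => pt2 (a t) (eta h)) (partial i1 f) _ (nbhs (pt2 (a t) (b t))));
    last exact: cp.
  by apply: cvg_pt2; [exact: cvg_cst|exact: squeeze db eta1].
Qed.

End plane.

(** * Rotation invariance of Lebesgue measure on the plane *)

Section rotation.
Context {R : realType}.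
Implicit Types (a b c s t : R) (x : 'rV[R]_2) (f : 'rV[R]_2 -> R).

Notation i1 := (lift ord0 ord0 : 'I_2).

(** Both sides are the same difference of values of an antiderivative of [h]. *)
Lemma integral_shift1 (h : R -> R) (M c : R) : continuous h ->
  (forall t, M < `|t| -> h t = 0) ->
  (\int[lebesgue_measure]_t (h (t + c))%:E = \int[lebesgue_measure]_t (h t)%:E)%E.
Proof.
move=> ch h0.
pose b : R := `|M| + 1.
have b0 : 0 < b by rewrite /b ltr_pwDr.
have [K dK] := continuous_antiderivative (- b - 1) ch.
have base (g : R -> R) (d : R) : (forall t, g t = h (t + d)) ->
    (\int[lebesgue_measure]_t (g t)%:E = (K b - K (- b))%:E)%E.
  move=> gE.
  have shc : continuous (fun t : R => t + d).
    by apply: contD; [move=> ?; exact: cvg_id|exact: cont_cst].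
  have cg : continuous g.
    rewrite (_ : g = h \o (fun t => t + d)); last exact/funext.
    by move=> t; apply: continuous_comp; [exact: shc|exact: ch].
  have dg t : - b - d <= t <= b - d -> is_derive t 1 (fun t => K (t + d)) (g t).
    move=> /andP[tb _].
    have dsh : is_derive t 1 (fun t => t + d) 1.
      by have := is_derive1_affine 1 d 0 t; under eq_fun do rewrite mul1r subr0.
    have dKs : is_derive (t + d) 1 K (h (t + d)).
      by apply: dK; lra.
    by have := @is_derive1_comp _ K (fun t => t + d) t _ _ dKs dsh; rewrite mulr1 gE.
  have bd : - b - d < b - d by rewrite ltrD2r gtrN.
  have := integral_antiderivative bd cg dg; rewrite !subrK => <-.
  rewrite [RHS]integral_mkcond; apply: eq_integral => t _.
  rewrite patchE; case: ifPn => // /negP tb; rewrite gE h0//.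
  rewrite ltNge; apply/negP => tM; apply: tb; rewrite inE /= in_itv /=.
  have : `|t + d| <= b by rewrite (le_trans tM)// (le_trans (ler_norm _))// lerDl.
  by rewrite ler_norml; lra.
by rewrite (base _ c (fun _ => erefl)) (base h 0)// => t; rewrite addr0.
Qed.

Lemma integral_rV1 (f : 'rV[R]_1 -> R) : cont_compact f ->
  (\int[lebesgue_rV 1]_y (f y)%:E =
   \int[lebesgue_measure]_b (f (cons_rV (b, 0 : 'rV[R]_0)))%:E)%E.
Proof.
move=> cf; rewrite (integral_rVS12 cf); apply: eq_integral => b _.
rewrite /= integral_dirac//; first by rewrite diracE in_setT mul1e.
apply/measurable_EFinP; apply: continuous_measurable_rV.
by case: (cont_compact_cons_rV b cf).
Qed.

Definition shear0 c x := pt2 (x 0 ord0 + c * x 0 i1) (x 0 i1).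
Definition shear1 c x := pt2 (x 0 ord0) (x 0 i1 + c * x 0 ord0).
Definition plane_rot c s x :=
  pt2 (c * x 0 ord0 - s * x 0 i1) (s * x 0 ord0 + c * x 0 i1).

Lemma norm_pt2 a b m : `|a| <= m -> `|b| <= m -> `|pt2 a b| <= m.
Proof.
move=> am bm; apply: norm_le_coord; first exact: le_trans am.
by move=> i; case: (ord2P i) => ->; rewrite pt2E.
Qed.

Lemma cont_compact_comp (f : 'rV[R]_2 -> R) (phi : 'rV[R]_2 -> 'rV[R]_2) (C : R) :
  0 < C -> continuous phi -> (forall x, `|x| <= C * `|phi x|) -> cont_compact f ->
  cont_compact (fun x => f (phi x)).
Proof.
move=> C0 cphi phiC [cf [M fM]]; split.
  by move=> x; apply: continuous_comp; [exact: cphi|exact: cf].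
exists (C * M) => x xM; apply: fM.
by rewrite -(ltr_pM2l C0) (lt_le_trans xM).
Qed.

Let cont0 : continuous (fun x => x 0 ord0). Proof. exact: coord_continuous. Qed.
Let cont1 : continuous (fun x => x 0 i1). Proof. exact: coord_continuous. Qed.

Lemma cont_shear0 c : continuous (shear0 c).
Proof. by apply: cont_pt2 => //; apply: contD => //; apply: contM => //; exact: cont_cst. Qed.
Lemma cont_shear1 c : continuous (shear1 c).
Proof. by apply: cont_pt2 => //; apply: contD => //; apply: contM => //; exact: cont_cst. Qed.

Lemma norm_lin2 a b d e : `|a * d + b * e| <= (`|a| + `|b|) * Num.max `|d| `|e|.
Proof.
apply: (le_trans (ler_normD _ _)); rewrite !normrM mulrDl; apply: lerD.
  by apply: ler_wpM2l => //; rewrite le_max lexx.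
by apply: ler_wpM2l => //; rewrite le_max lexx orbT.
Qed.

Lemma max_norm_le x : Num.max `|x 0 ord0| `|x 0 i1| <= `|x|.
Proof. by rewrite ge_max !coord_le_norm. Qed.

Lemma cont_compact_shear0 c f : cont_compact f -> cont_compact (fun x => f (shear0 c x)).
Proof.
apply: (@cont_compact_comp _ _ (1 + `|c|)); [by rewrite ltr_pwDl|exact: cont_shear0|].
move=> x; rewrite -[x in leLHS]pt2_eta.
have H a b : `|a * (shear0 c x) 0 ord0 + b * (shear0 c x) 0 i1| <=
     (`|a| + `|b|) * `|shear0 c x|.
  by apply: (le_trans (norm_lin2 _ _ _ _)); apply: ler_wpM2l;
    [rewrite addr_ge0|exact: max_norm_le].
apply: norm_pt2.
  have := H 1 (- c); rewrite normr1 normrN !pt2E.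
  by rewrite (_ : 1 * _ + _ = x 0 ord0)//; ring.
have := H 0 1; rewrite normr1 normr0 !pt2E mul0r mul1r !add0r => /le_trans; apply.
by rewrite ler_wpM2r// lerDl.
Qed.

Lemma cont_compact_shear1 c f : cont_compact f -> cont_compact (fun x => f (shear1 c x)).
Proof.
apply: (@cont_compact_comp _ _ (1 + `|c|)); [by rewrite ltr_pwDl|exact: cont_shear1|].
move=> x; rewrite -[x in leLHS]pt2_eta.
have H a b : `|a * (shear1 c x) 0 ord0 + b * (shear1 c x) 0 i1| <=
     (`|a| + `|b|) * `|shear1 c x|.
  by apply: (le_trans (norm_lin2 _ _ _ _)); apply: ler_wpM2l;
    [rewrite addr_ge0|exact: max_norm_le].
apply: norm_pt2.
  have := H 1 0; rewrite normr1 normr0 !pt2E mul0r mul1r !addr0 => /le_trans; apply.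
  by rewrite ler_wpM2r// lerDl.
have := H (- c) 1; rewrite normr1 normrN addrC !pt2E [`|c| + 1]addrC.
by rewrite (_ : 1 * _ + _ = x 0 i1)//; ring.
Qed.

Lemma pt2_cons a (y : 'rV[R]_1) : cons_rV (a, y) = pt2 a (y 0 ord0).
Proof.
rewrite -[LHS]pt2_eta mxE unlift_none mxE liftK; congr pt2.
Qed.

Lemma integral_shear0 c f : cont_compact f ->
  (\int[lebesgue_rV 2]_x (f (shear0 c x))%:E = \int[lebesgue_rV 2]_x (f x)%:E)%E.
Proof.
move=> cf; rewrite (integral_rVS21 (cont_compact_shear0 c cf)) (integral_rVS21 cf).
apply: eq_integral => y _.
have [cf1 [M fM]] := cf.
rewrite -(@integral_shift1 (fun a => f (cons_rV (a, y))) M (c * y 0 ord0)).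
- by apply: eq_integral => a _; rewrite !pt2_cons /shear0 !pt2E.
- by move=> a; apply: continuous_comp; [exact: continuous_cons_rVl|exact: cf1].
- by move=> t tM; apply: fM; apply: lt_le_trans tM (cons_rV_norm_gel _ _).
Qed.

Lemma integral_shear1 c f : cont_compact f ->
  (\int[lebesgue_rV 2]_x (f (shear1 c x))%:E = \int[lebesgue_rV 2]_x (f x)%:E)%E.
Proof.
move=> cf; rewrite (integral_rVS12 (cont_compact_shear1 c cf)) (integral_rVS12 cf).
apply: eq_integral => a _.
rewrite (integral_rV1 (cont_compact_cons_rV a (cont_compact_shear1 c cf))) (integral_rV1 (cont_compact_cons_rV a cf)).
have [cf1 [M fM]] := cont_compact_cons_rV a cf.
rewrite -(@integral_shift1 (fun b => f (cons_rV (a, cons_rV (b, 0)))) M (c * a)).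
- by apply: eq_integral => b _; rewrite -!/(pt2 _ _) /shear1 !pt2E.
- by move=> b; apply: (@continuous_comp _ _ _ (fun b => cons_rV (b, 0 : 'rV[R]_0))
    (fun y => f (cons_rV (a, y)))); [exact: continuous_cons_rVl|exact: cf1].
- by move=> t tM; apply: fM; apply: lt_le_trans tM (cons_rV_norm_gel _ _).
Qed.

(** A rotation other than the half-turn is a product of three shears, each of which
    is a translation on every line of a family; the half-turn is the square of a
    quarter-turn. *)
Lemma integral_rot c s f : c ^+ 2 + s ^+ 2 = 1 -> cont_compact f ->
  cont_compact (fun x => f (plane_rot c s x)) /\
  (\int[lebesgue_rV 2]_x (f (plane_rot c s x))%:E = \int[lebesgue_rV 2]_x (f x)%:E)%E.
Proof.
move=> + cf.
have gen c' s' g : cont_compact g -> c' ^+ 2 + s' ^+ 2 = 1 -> 1 + c' != 0 ->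
    cont_compact (fun x => g (plane_rot c' s' x)) /\
    (\int[lebesgue_rV 2]_x (g (plane_rot c' s' x))%:E = \int[lebesgue_rV 2]_x (g x)%:E)%E.
  move=> cg cs c0;
  (* If c' and s' are the cosine and sine of t, then al is - tan(t / 2). *)
  pose al := - (s' / (1 + c')).
  have E : (fun x => g (plane_rot c' s' x)) =
      (fun x => g (shear0 al (shear1 s' (shear0 al x)))).
    apply/funext => x; congr g; rewrite /shear0 /shear1 /plane_rot !pt2E.
    have sc : s' * al = c' - 1.
      have s2 : s' ^+ 2 = 1 - c' ^+ 2 by rewrite -cs; ring.
      apply: (mulIf c0); transitivity (- s' ^+ 2); first by rewrite /al; field.
      by rewrite s2; ring.
    have ac : al * (1 + c') = - s' by rewrite /al mulNr divfK.
    have c1E : x 0 i1 + s' * (x 0 ord0 + al * x 0 i1) = s' * x 0 ord0 + c' * x 0 i1.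
      by rewrite mulrDr mulrA sc; ring.
    rewrite c1E; congr pt2.
    have -> : s' * x 0 ord0 = - al * (1 + c') * x 0 ord0 by rewrite mulNr ac opprK.
    have -> : s' * x 0 i1 = - al * (1 + c') * x 0 i1 by rewrite mulNr ac opprK.
    have al2 : al * al * (1 + c') = 1 - c'.
      by rewrite -mulrA ac mulrN mulrC sc; ring.
    transitivity (x 0 ord0 * (1 - al * al * (1 + c')) + (al + al * c') * x 0 i1);
      last by ring.
    by rewrite al2; ring.
  split.
    by rewrite E; apply: (cont_compact_shear0 al (f := fun x => g (shear0 al (shear1 s' x))));
      apply: (cont_compact_shear1 s' (f := fun x => g (shear0 al x))); exact: cont_compact_shear0.
  under eq_integral => x _ do rewrite -[g (plane_rot _ _ x)]/((fun x => g (plane_rot c' s' x)) x) E.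
  have h1 := cont_compact_shear0 al cg.
  have h2 := cont_compact_shear1 s' h1.
  by rewrite (integral_shear0 al h2) (integral_shear1 s' h1) integral_shear0.
move=> cs; have [c0|c0] := eqVneq (1 + c) 0; last exact: gen.
have cE : c = -1 by apply/eqP; rewrite -addr_eq0 addrC c0.
have sE : s = 0.
  by apply/eqP; rewrite -sqrf_eq0; move: cs; rewrite cE sqrrN expr1n => /(canRL (addKr _)) ->; rewrite addNr.
have rr x : plane_rot c s x = plane_rot 0 1 (plane_rot 0 1 x).
  by rewrite /plane_rot !pt2E cE sE; congr pt2; ring.
under eq_fun do rewrite rr.
have q : (0 : R) ^+ 2 + 1 ^+ 2 = 1 by rewrite expr0n expr1n add0r.
have q' : 1 + (0 : R) != 0 by rewrite addr0 oner_neq0.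
have [h1 h2] := gen 0 1 f cf q q'.
have [h3 h4] := gen 0 1 _ h1 q q'.
split => //; rewrite -h2 -h4.
by under eq_integral do rewrite rr.
Qed.

End rotation.

(** * Averaging over rotations *)

Section average.
Context {R : realType}.
Implicit Types (x : 'rV[R]_2).

Notation i1 := (lift ord0 ord0 : 'I_2).

Lemma norm_rot (c s : R) x : c ^+ 2 + s ^+ 2 = 1 -> `|x| <= 2 * `|plane_rot c s x|.
Proof.
move=> cs.
have c1 : `|c| <= 1.
  by rewrite -sqrtr_sqr -[leRHS]sqrtr1 ler_wsqrtr// -cs lerDl sqr_ge0.
have s1 : `|s| <= 1.
  by rewrite -sqrtr_sqr -[leRHS]sqrtr1 ler_wsqrtr// -cs lerDr sqr_ge0.
have H a b : `|a| <= 1 -> `|b| <= 1 ->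
    `|a * (plane_rot c s x) 0 ord0 + b * (plane_rot c s x) 0 i1| <= 2 * `|plane_rot c s x|.
  move=> a1 b1; apply: (le_trans (norm_lin2 _ _ _ _)); apply: ler_pM.
  - by rewrite addr_ge0.
  - by rewrite le_max normr_ge0.
  - by rewrite (_ : 2 = 1 + 1)// lerD.
  - exact: max_norm_le.
rewrite -[x in leLHS]pt2_eta; apply: norm_pt2.
  have := H c s c1 s1; rewrite !pt2E (_ : c * _ + s * _ = (c ^+ 2 + s ^+ 2) * x 0 ord0); last by ring.
  by rewrite cs mul1r.
have := H (- s) c; rewrite normrN => /(_ s1 c1).
rewrite !pt2E (_ : - s * _ + c * _ = (c ^+ 2 + s ^+ 2) * x 0 i1); last by ring.
by rewrite cs mul1r.
Qed.

(** Fubini's theorem on [[0, 2 pi] x R^2]: integrating first over the plane gives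
    [2 pi] times the integral of [k], by rotation invariance. *)
Lemma rot_average (k : 'rV[R]_2 -> R) : cont_compact k ->
  (forall x, (0 <= \int[lebesgue_measure]_(t in `[0%R, (pi *+ 2)%R])
     (k (plane_rot (cos t) (sin t) x))%:E)%E) ->
  (0 <= \int[lebesgue_rV 2]_x (k x)%:E)%E.
Proof.
move=> ck av.
have pi2 : 0 < pi *+ 2 :> R by rewrite pmulrn_lgt0// pi_gt0.
pose I : set (measurableTypeR R) := `[0, pi *+ 2]%classic.
pose F (z : measurableTypeR R * 'rV[R]_2) : R := k (plane_rot (cos z.1) (sin z.1) z.2).
have mF : measurable_fun setT F.
  pose H (z : 'rV[R]_3) : R := k (plane_rot (cos (z 0 ord0)) (sin (z 0 ord0)) (\row_j z 0 (lift ord0 j))).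
  have -> : F = H \o @cons_rV R 2.
    apply/funext => -[t x]; rewrite /F /H /= mxE unlift_none; congr (k (plane_rot _ _ _)).
    by apply/rowP => j; rewrite !mxE liftK.
  apply: measurableT_comp; last exact: measurable_cons_rV.
  apply: continuous_measurable_rV => z.
  have cz i : continuous (fun z : 'rV[R]_3 => z 0 i) by exact: coord_continuous.
  have cz' (g : R -> R) i : continuous g -> continuous (fun z : 'rV[R]_3 => g (z 0 i)).
    by move=> cg y; apply: continuous_comp; [exact: cz|exact: cg].
  have E j : (fun z : 'rV[R]_3 => (\row_j0 z 0 (lift ord0 j0)) 0 j) = (fun z => z 0 (lift ord0 j)).
    by apply/funext => y; rewrite mxE.
  have cc' : continuous (fun z : 'rV[R]_3 => cos (z 0 ord0)) by apply: cz'; exact: continuous_cos.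
  have cs' : continuous (fun z : 'rV[R]_3 => sin (z 0 ord0)) by apply: cz'; exact: continuous_sin.
  have cr j : continuous (fun z : 'rV[R]_3 => (\row_j0 z 0 (lift ord0 j0)) 0 j).
    by rewrite E; exact: cz.
  pose ph (z : 'rV[R]_3) := plane_rot (cos (z 0 ord0)) (sin (z 0 ord0)) (\row_j z 0 (lift ord0 j)).
  have cph : continuous ph.
    by apply: cont_pt2; [apply: contB|apply: contD]; apply: contM.
  apply: (@continuous_comp _ _ _ ph k); first exact: cph.
  by case: ck => + _; exact.
have cs t : (cos t : R) ^+ 2 + sin t ^+ 2 = 1 by exact: cos2Dsin2.
pose FI := F \_ (I `*` setT).
have mI : measurable I by exact: measurable_itv.
have intF : (lebesgue_measure \x lebesgue_rV 2)%E.-integrable setT (EFin \o FI).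
  have [_ [M kM]] := ck.
  pose Q := I `*` cube 2 (`|2 * M|).
  have mQ : measurable Q by apply: measurableX => //; exact: measurable_cube.
  have -> : FI = F \_ Q.
    apply/funext => -[t x]; rewrite /FI /Q !patchE.
    have [/set_mem[/= tI _]|tI] := boolP ((t, x) \in I `*` setT).
      case: ifPn => // /negP tQ; apply: kM; rewrite -(ltr_pM2l (_ : 0 < 2))//.
      apply: (lt_le_trans _ (norm_rot x (cs t))); rewrite ltNge; apply/negP => xM.
      apply: tQ; rewrite inE; split => //= i.
      apply: (le_trans (coord_le_norm _ _)); apply: (le_trans xM); exact: ler_norm.
    case: ifPn => // /set_mem[/= tI' _].
    by exfalso; move/negP : tI; apply; rewrite inE; split.
  rewrite -restrict_EFin; apply/(integrable_restrict _ mQ) => //; rewrite setTI.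
  apply: measurable_bounded_integrable => //.
  - have : (lebesgue_measure I * lebesgue_rV 2 (cube 2 `|(2 * M)%R|) < +oo)%E.
      apply: lte_mul_pinfty => //; last exact: lebesgue_rV_cube.
      rewrite ge0_fin_numE// /I /= lebesgue_measure_itv.
      by case: ifP => // _; rewrite -EFinD ltry.
    by rewrite -product_measure1E//; exact: measurable_cube.
  - exact: measurable_funTS.
  - have [B kB] := cont_compact_bounded ck.
    exists B; split; first exact: num_real.
    by move=> c Bc x _ /=; exact: le_trans (kB _) (ltW Bc).
pose J := (\int[lebesgue_rV 2]_x (k x)%:E)%E.
have finJ : J \is a fin_num by apply: integrable_fin_num => //; exact: cont_compact_integrable.
have inner t : (\int[lebesgue_rV 2]_x (FI (t, x))%:E = ((fun=> J) \_ I) t)%E.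
  rewrite patchE; case: ifPn => tI.
    rewrite -[RHS](integral_rot (cs t) ck).2; apply: eq_integral => x _.
    by rewrite /FI patchE ifT// inE; split => //; exact: set_mem.
  rewrite integral0_eq// => x _; rewrite /FI patchE ifF//.
  by apply/negP => /set_mem[/= tI' _]; move/negP : tI; apply; exact: mem_set.
have e1 : (\int[lebesgue_measure \x lebesgue_rV 2]_z (FI z)%:E = J * (pi *+ 2)%:E)%E.
  rewrite -(integral12_prod_meas1 intF) /fubini_F.
  under eq_integral do rewrite /= inner.
  rewrite -integral_mkcond integral_cst// /I /= lebesgue_measure_itv /= lte_fin pi2.
  by rewrite -EFinD subr0.
have e2 : (0 <= \int[lebesgue_measure \x lebesgue_rV 2]_z (FI z)%:E)%E.
  rewrite -(integral21_prod_meas1 intF); apply: integral_ge0 => x _.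
  rewrite /fubini_G (_ : (\int[_]_t _ = \int[lebesgue_measure]_(t in I) (F (t, x))%:E)%E).
    exact: av.
  rewrite [RHS]integral_mkcond; apply: eq_integral => t _.
  rewrite /= /FI !patchE; case: (boolP (t \in I)) => tI.
    by rewrite ifT// inE; split => //; exact: set_mem.
  rewrite ifF//.
  by apply/negP => /set_mem[/= tI' _]; move/negP : tI; apply; exact: mem_set.
move: e2; rewrite e1 -/J -(fineK finJ) -EFinM !lee_fin.
by rewrite pmulr_lge0.
Qed.

End average.

(** * The tangential term in the plane *)

Section planar.
Context {R : realType} (rho : \bar R) (K : set 'rV[R]_2).
Hypothesis KO : forall x, K x -> oitv0 rho (enorm x).
Variables (u : 'rV[R]_2 -> R) (p : 'I_2 -> 'rV[R]_2 -> R)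
  (A : 'I_2 -> 'I_2 -> 'rV[R]_2 -> R).
Hypotheses (cu : c1 u) (cp : forall i, c1 (p i)).
Hypotheses (du : forall i x, partial i u x = p i x)
  (dp : forall i j x, partial i (p j) x = A i j x).
Hypotheses (symA : forall i j x, A i j x = A j i x).
Hypothesis sp : forall i, supported K (p i).
Hypothesis sA : forall i j, supported K (A i j).
Implicit Types x : 'rV[R]_2.

Notation i1 := (lift ord0 ord0 : 'I_2).

(** Given the partial derivatives [q] of a function, this is its derivative along the
    rotation field [x_0 d_1 - x_1 d_0], that is, with respect to the polar angle. *)
Definition angular (q : 'I_2 -> 'rV[R]_2 -> R) x : R :=
  x 0 ord0 * q i1 x - x 0 i1 * q ord0 x.

Lemma c1_angular : c1 (angular p) /\ forall i x, partial i (angular p) x =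
  (i == ord0)%:R * p i1 x + x 0 ord0 * A i i1 x
  - ((i == i1)%:R * p ord0 x + x 0 i1 * A i ord0 x).
Proof.
have [h1 h2] := c1M (proj1 (@c1_coord R 2 ord0)) (cp i1).
have [h3 h4] := c1M (proj1 (@c1_coord R 2 i1)) (cp ord0).
have [h5 h6] := c1N h3.
have [h7 h8] := c1D h1 h5.
split => // i x.
by rewrite h8 h6 h4 h2 !(proj2 (c1_coord _)) !dp.
Qed.

Lemma tang_angular x :
  tang p A x = angular (fun i => partial i (angular p)) x ^+ 2 - angular p x ^+ 2.
Proof.
rewrite {1}/angular !(proj2 c1_angular) /angular /tang /hess2 /AxAx /xAx /lap /xp /pp /Ax.
have -> : enorm x ^+ 4 = (enorm x ^+ 2) ^+ 2 by rewrite -exprM.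
rewrite enorm_sqr !(big_ord_recl, big_ord0) /=.
rewrite (symA i1 ord0 x); ring.
Qed.

Lemma enorm_rot (c s : R) x : c ^+ 2 + s ^+ 2 = 1 -> enorm (plane_rot c s x) = enorm x.
Proof.
move=> cs; rewrite /enorm; congr Num.sqrt.
rewrite !big_ord_recl !big_ord0 !pt2E !addr0.
transitivity ((c ^+ 2 + s ^+ 2) * (x 0 ord0 ^+ 2 + x 0 i1 ^+ 2)); first by ring.
by rewrite cs mul1r.
Qed.

Lemma is_derive_rot (f : 'rV[R]_2 -> R) x (t : R) : c1 f ->
  is_derive t 1 (fun t => f (plane_rot (cos t) (sin t) x))
    (angular (fun i => partial i f) (plane_rot (cos t) (sin t) x)).
Proof.
move=> cf.
have lin (a b : R) (f1 f2 : R -> R) d1 d2 : is_derive t 1 f1 d1 -> is_derive t 1 f2 d2 ->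
    is_derive t 1 (fun t => f1 t * a + f2 t * b) (d1 * a + d2 * b).
  move=> h1 h2; have := is_deriveD (is_derive1M h1 (is_derive_cst a t 1))
    (is_derive1M h2 (is_derive_cst b t 1)).
  by move=> /is_derive_eq; apply; rewrite /cst; ring.
have da := lin (x 0 ord0) (- x 0 i1) _ _ _ _ (is_derive_cos t) (is_derive_sin t).
have db := lin (x 0 ord0) (x 0 i1) _ _ _ _ (is_derive_sin t) (is_derive_cos t).
have := is_derive_curve cf da db.
have E s : pt2 (cos s * x 0 ord0 + sin s * - x 0 i1)
    (sin s * x 0 ord0 + cos s * x 0 i1) = plane_rot (cos s) (sin s) x.
  by rewrite /plane_rot mulrN.
under eq_fun do rewrite E.
by move=> /is_derive_eq; apply; rewrite E /angular !pt2E; ring.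
Qed.

(** The weight is invariant under rotations, so Wirtinger's inequality along the circle
    through [x] applies to the multiple of [u] by the square root of its value. *)
Lemma tang_nonneg2 (V : R -> R) : (forall r, oitv0 rho r -> 0 <= V r) ->
  cont_compact (fun x => V (enorm x) * (enorm x)^-1 ^+ 4 * tang p A x) ->
  nonneg_integral (fun x => V (enorm x) * (enorm x)^-1 ^+ 4 * tang p A x).
Proof.
move=> V0 ck; split => //; apply: rot_average => // x.
have cs t : (cos t : R) ^+ 2 + sin t ^+ 2 = 1 by exact: cos2Dsin2.
have [xO|xO] := pselect (oitv0 rho (enorm x)); last first.
  apply: integral_ge0 => t _; rewrite lee_fin.
  rewrite (supported_tang sp sA) ?mulr0// => /KO.
  by rewrite enorm_rot.
pose w := V (enorm x) * (enorm x)^-1 ^+ 4.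
have w0 : 0 <= w by rewrite mulr_ge0 ?V0// exprn_ge0// invr_ge0 enorm_ge0.
pose c : R := Num.sqrt w.
pose curve (f : 'rV[R]_2 -> R) (t : R) : R := c * f (plane_rot (cos t) (sin t) x).
have dcurve (f : 'rV[R]_2 -> R) (t : R) : c1 f -> is_derive t 1 (curve f) (curve (angular (fun i => partial i f)) t).
  move=> cf; have := is_derive1M (is_derive_cst c t 1) (is_derive_rot x t cf).
  by move=> /is_derive_eq; apply; rewrite /cst mul0r add0r.
have uE : angular (fun i => partial i u) = angular p.
  by apply/funext => y; rewrite /angular !du.
have dg (t : R) : is_derive t 1 (curve u) (curve (angular p) t) by rewrite -uE; exact: dcurve.
have dg1 t := dcurve (angular p) t c1_angular.1.
have per f : periodic (curve f) (pi *+ 2).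
  by move=> t; rewrite /curve cosD2pi sinD2pi.
have cg2 : continuous (curve (angular (fun i => partial i (angular p)))).
  have crot : continuous (fun t : R => plane_rot (cos t) (sin t) x).
    by apply: cont_pt2; [apply: contB|apply: contD]; apply: contM;
      (exact: cont_cst || exact: continuous_cos || exact: continuous_sin).
  apply: contM; first exact: cont_cst.
  move=> t; apply: (@continuous_comp _ _ _ (fun t : R => plane_rot (cos t) (sin t) x)
    (angular (fun i => partial i (angular p)))); first exact: crot.
  have cpart i : continuous (partial i (angular p)) by case: c1_angular => -[_ _ + _].
  by apply: contB; apply: contM => //; exact: coord_continuous.
have := wirtinger dg dg1 cg2 (per _) (per _) (per _).
congr (0 <= _)%E; apply: eq_integral => t _; congr EFin.
rewrite enorm_rot// tang_angular /curve -/w !exprMn -mulrBr.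
by rewrite /c sqr_sqrtr.
Qed.

End planar.

(** * The weighted Hardy-Rellich inequality *)

Section hardy_rellich.
Context {R : realType} (n : nat) (rho : \bar R) (K : set 'rV[R]_n).
Hypothesis n0 : (0 < n)%N.
Hypothesis cK : compact K.
Hypothesis KO : forall x, K x -> oitv0 rho (enorm x).
Variables (u : 'rV[R]_n -> R) (p : 'I_n -> 'rV[R]_n -> R)
  (A : 'I_n -> 'I_n -> 'rV[R]_n -> R) (T : 'I_n -> 'I_n -> 'I_n -> 'rV[R]_n -> R).
Hypotheses (cu : c1 u) (cp : forall i, c1 (p i)) (cA : forall i j, c1 (A i j)).
Hypotheses (du : forall i x, partial i u x = p i x)
  (dp : forall i j x, partial i (p j) x = A i j x)
  (dA : forall i j k x, partial i (A j k) x = T i j k x).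
Hypotheses (symA : forall i j x, A i j x = A j i x)
  (symT : forall i j k x, T i j k x = T j i k x).
Hypothesis sp : forall i, supported K (p i).
Hypothesis sA : forall i j, supported K (A i j).
Variables (V dV ddV : R -> R).
Hypothesis DV : forall r, oitv0 rho r -> is_derive r 1 V (dV r).
Hypothesis DdV : forall r, oitv0 rho r -> is_derive r 1 dV (ddV r).
Hypothesis cddV : forall r, oitv0 rho r -> {for r, continuous ddV}.
Hypothesis V0 : forall r, oitv0 rho r -> 0 <= V r.

Lemma tang_nonneg :
  nonneg_integral (fun x => V (enorm x) * (enorm x)^-1 ^+ 4 * tang p A x).
Proof.
have cV := cont_compact_Vtang cK KO cp cA sp sA DV.
have [n1|n1] := eqVneq n 1%N; first exact: (tang_nonneg1 cK KO cp cA symA sp sA DV V0 n1).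
have [n2|n2] := eqVneq n 2%N; last first.
  apply: (tang_nonneg3 n0 cK KO cp cA dp dA symA symT sp sA DV DdV V0).
  by case: n n0 n1 n2 => [|[|[|m]]].
clear -n2 KO cu cp du dp symA sp sA V0 cV.
subst n; exact: (tang_nonneg2 KO cu cp du dp symA sp sA V0 cV).
Qed.

Let integral_eball (f : 'rV[R]_n -> R) : supported K f ->
  (\int[lebesgue_rV n]_(x in eball rho) (f x)%:E = \int[lebesgue_rV n]_x (f x)%:E)%E.
Proof.
move=> sf; rewrite integral_mkcond; apply: eq_integral => x _.
rewrite patchE; case: ifPn => // /negP xb; rewrite sf// => /KO[_ xr].
by apply: xb; rewrite inE.
Qed.

Lemma hardy_rellich (W phi : R -> R) :
  let flux := fun t : R => t ^+ n.-1 * V t * derive1 phi t in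
  (forall r, oitv0 rho r -> {for r, continuous W}) ->
  (forall r, oitv0 rho r -> [/\ 0 < phi r, derivable phi r 1,
      derivable flux r 1 & derive1 flux r + r ^+ n.-1 * W r * phi r = 0]) ->
  (forall r, oitv0 rho r ->
    ddV r - 3 * (dV r / r) - (n%:R - 5) * (V r / r ^+ 2) <= 0) ->
  (\int[lebesgue_rV n]_(x in eball rho) (W (enorm x) * pp p x)%:E
   + (n%:R - 1)%:E * \int[lebesgue_rV n]_(x in eball rho)
       ((V (enorm x) / enorm x ^+ 2 - dV (enorm x) / enorm x) * pp p x)%:E
   <= \int[lebesgue_rV n]_(x in eball rho) (V (enorm x) * lap A x ^+ 2)%:E)%E.
Proof.
move=> flux cW bessel hV.
have ccV r : oitv0 rho r -> {for r, continuous V}.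
  by move=> r0; exact: is_derive1_continuous (DV r0).
have ccdV r : oitv0 rho r -> {for r, continuous dV}.
  by move=> r0; exact: is_derive1_continuous (DdV r0).
have spp := supported_pp sp.
have slap2 : supported K (fun x => lap A x ^+ 2).
  by move=> x Kx; rewrite (supported_lap sA)// expr0n.
have clap2 : continuous (fun x => lap A x ^+ 2).
  by under eq_fun do rewrite expr2; apply: contM; exact: cont_lap.
have c1 := radial_cont_compact cK KO ccV clap2 slap2.
have c2 := radial_cont_compact cK KO cW (cont_pp cp) spp.
have c3 : cont_compact (fun x => (V (enorm x) / enorm x ^+ 2 - dV (enorm x) / enorm x) * pp p x).
  apply: (radial_cont_compact (g := fun r => V r / r ^+ 2 - dV r / r) cK KO _ (cont_pp cp) spp).
  move=> r r0; have rn0 : r != 0 by rewrite gt_eqF//; case: r0.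
  have ci : {for r, continuous (fun r : R => r^-1)} by exact: inv_continuous.
  have cM (f g : R -> R) : {for r, continuous f} -> {for r, continuous g} ->
      {for r, continuous (fun x => f x * g x)}.
    by move=> cf cg; exact: (continuousM cf cg).
  apply: (@continuousB _ _ _ (fun r => V r / r ^+ 2) (fun r => dV r / r)).
    apply: cM; first exact: ccV.
    have -> : (fun r : R => (r ^+ 2)^-1) = (fun r => r^-1 ^+ 2).
      by apply/funext => t; rewrite exprVn.
    exact: (@continuous_powV R rho 2 r r0).
  by apply: cM => //; exact: ccdV.
have c4 : cont_compact (fun x => (n%:R - 1) *
    ((V (enorm x) / enorm x ^+ 2 - dV (enorm x) / enorm x) * pp p x)).
  by apply: cont_compactMl c3; exact: cont_cst.
have c24 := cont_compactD c2 c4.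
have := energy_nonneg n0 cK KO cp cA dp dA symA symT sp sA DV DdV cddV V0 cW bessel hV tang_nonneg.
have cI : cont_compact (fun x => V (enorm x) * lap A x ^+ 2 - W (enorm x) * pp p x
    - (n%:R - 1) * ((V (enorm x) / enorm x ^+ 2 - dV (enorm x) / enorm x) * pp p x)).
  exact: cont_compactD (cont_compactD c1 (cont_compactN c2)) (cont_compactN c4).
move=> /(_ cI)[_ I0].
rewrite !integral_eball; first last.
- by move=> x Kx; rewrite spp// mulr0.
- by move=> x Kx; rewrite spp// mulr0.
- by move=> x Kx; rewrite slap2// mulr0.
have -> : (\int[lebesgue_rV n]_x (V (enorm x) * lap A x ^+ 2)%:E =
  \int[lebesgue_rV n]_x ((W (enorm x) * pp p x + (n%:R - 1) *
    ((V (enorm x) / enorm x ^+ 2 - dV (enorm x) / enorm x) * pp p x)) +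
   (V (enorm x) * lap A x ^+ 2 - W (enorm x) * pp p x
    - (n%:R - 1) * ((V (enorm x) / enorm x ^+ 2 - dV (enorm x) / enorm x) * pp p x)))%:E)%E.
  by apply: eq_integral => x _; congr EFin; ring.
rewrite integral_cont_compactD// (integral_cont_compactD c2 c4).
rewrite -integralZl//; last exact: cont_compact_integrable c3.
by under [X in (_ + X <= _)%E]eq_integral do rewrite -EFinM; rewrite leeDl.
Qed.

End hardy_rellich.

Theorem theorem1p5 (R : realType) (N : nat) (rho : \bar R) (V1 W1 : R -> R)
  (hN : (1 <= N)%N) (hrho : (0 < rho)%E)
  (smoothV1 : smooth_on (oitv0 rho) V1)
  (smoothW1 : smooth_on (oitv0 rho) W1)
  (V1_ge0 : forall r, oitv0 rho r -> 0 <= V1 r)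
  (bessel : bessel_pair N rho V1 W1)
  (hV1 : forall r, oitv0 rho r ->
    derive1n 2 V1 r - 3 * (derive1 V1 r / r) - (N%:R - 5) * (V1 r / r ^+ 2) <= 0)
  (u : 'rV[R]_N -> R)
  (hu : test_function (eball rho `\ (0 : 'rV[R]_N)) u) :
  (\int[lebesgue_rV N]_(x in eball rho)
      (V1 (enorm x) * `|laplacian u x| ^+ 2)%:E
   >= \int[lebesgue_rV N]_(x in eball rho)
        (W1 (enorm x) * enorm (grad u x) ^+ 2)%:E
      + (N%:R - 1)%:E *
        \int[lebesgue_rV N]_(x in eball rho)
          ((V1 (enorm x) / enorm x ^+ 2 - derive1 V1 (enorm x) / enorm x)
             * enorm (grad u x) ^+ 2)%:E)%E.
Proof.
have [su cK KO] := hu; have [_ [phi hphi]] := bessel.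
have DV r : oitv0 rho r -> is_derive r 1 V1 (derive1 V1 r).
  by move=> r0; rewrite derive1E; apply: derivableP; exact: (smoothV1 0%N).
have DdV r : oitv0 rho r -> is_derive r 1 (derive1 V1) (derive1n 2 V1 r).
  move=> r0; rewrite [derive1n 2 V1 r]derive1E; apply: derivableP.
  exact: (smoothV1 1%N).
have cddV r : oitv0 rho r -> {for r, continuous (derive1n 2 V1)}.
  by move=> r0; exact: is_derive1_continuous (derivableP (smoothV1 2%N r r0)).
have cW r : oitv0 rho r -> {for r, continuous W1}.
  by move=> r0; exact: is_derive1_continuous (derivableP (smoothW1 0%N r r0)).
have KO' x : closure [set x | u x != 0] x -> oitv0 rho (enorm x).
  move=> /KO[xr /eqP x0]; split => //.
  by rewrite lt_def enorm_ge0 enorm_eq0 x0.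
have := hardy_rellich hN cK KO' (smooth_c1 [::] su)
  (fun i => smooth_c1 [:: i] su) (fun i j => smooth_c1 [:: i; j] su)
  (fun _ _ => erefl) (fun _ _ _ => erefl)
  (fun i j k x => erefl (iter_partial [:: i; j; k] u x))
  (fun i j x => congr1 (@^~ x) (iter_partial_schwarz i j [::] su))
  (fun i j k x => congr1 (@^~ x) (iter_partial_schwarz i j [:: k] su))
  (fun i => @supported_iter_partial R N u [:: i])
  (fun i j => @supported_iter_partial R N u [:: i; j])
  DV DdV cddV V1_ge0 cW hphi hV1.
have gE x : pp (fun i => iter_partial [:: i] u) x = enorm (grad u x) ^+ 2.
  rewrite enorm_sqr; apply: eq_bigr => i _.
  by rewrite mxE expr2.
under eq_integral do rewrite gE.
under [X in (_ + _ * X <= _)%E -> _]eq_integral do rewrite gE.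
by under [X in (_ <= X)%E -> _]eq_integral do rewrite -real_normK ?num_real//.
Qed.
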